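(* Let $k$ be a commutative field, $A$ a commutative $k$-algebra without zero divisors, $(H,m_H,\Delta_H,\eta_H,\varepsilon_H,S_H)$ an $A$-Hopf algebra, and $F\in H\otimes_A H$ a Drinfeld twist. Set $(C,\Delta_C,\varepsilon_C):=(H,\Delta_H F^{-1},\varepsilon_H)$, i.e. $\Delta_C(x)=\Delta_H(x)F^{-1}$, and let $\theta_C$ be the $A$-linear map defined on $C$ by $\theta_C(x)=S_H^2(x)\,S_H(u_F)\,u_F^{-1}$ for all $x\in C$, where $u_F:=m_H\circ(\mathrm{Id}_H\otimes S_H)(F)$, and let $$\nu_C:C\otimes_A C^{\mathrm{cop}}\otimes_A C\to C,\qquad x\otimes y\otimes z\mapsto x\,u_F\,S_H(y)\,z .$$ Then $\theta_C$ is an $A$-coalgebra automorphism of the $A$-coalgebra $(C,\Delta_C,\varepsilon_C)$, $\nu_C$ is an $A$-coalgebra morphism, and the quintuple $(C,\Delta_C,\varepsilon_C,\nu_C,\theta_C)$ is an $A$-cotorsor whose Hopf algebra $H_l(C)$ acting from the left (resp. $H_r(C)$ acting from the right) on $C$ is isomorphic to $H$ (resp. $H_F$).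
   Context: A Drinfeld twist is an invertible element $F\in H\otimes_A H$ satisfying $(F\otimes 1)(\Delta_H\otimes \mathrm{Id}_H)(F)=(1\otimes F)(\mathrm{Id}_H\otimes\Delta_H)(F)$ and $(\varepsilon_H\otimes \mathrm{Id}_H)(F)=(\mathrm{Id}_H\otimes\varepsilon_H)(F)=1$. Then $u_F=m_H\circ(\mathrm{Id}_H\otimes S_H)(F)$ is invertible with $u_F^{-1}=m_H\circ(S_H\otimes \mathrm{Id}_H)(F^{-1})$, and $H_F$ denotes the $A$-Hopf algebra $(H,m_H,\Delta_F,\eta_H,\varepsilon_H,S_F)$ with $\Delta_F:=F\Delta_H F^{-1}$ and $S_F:=u_F S_H u_F^{-1}$. For a coalgebra $C$, $C^{\mathrm{cop}}$ is the coalgebra with opposite coproduct. An $A$-cotorsor is a quintuple $(C,\Delta_C,\varepsilon_C,\nu_C,\theta_C)$ where $(C,\Delta_C,\varepsilon_C)$ is an $A$-coalgebra, $\nu_C:C\otimes_A C^{\mathrm{cop}}\otimes_A C\to C$ is an $A$-coalgebra morphism and $\theta_C:C\to C$ is a coalgebra automorphism such that: (i) $\nu_C\circ(\Delta_C\otimes \mathrm{Id}_C)=\varepsilon_C\otimes \mathrm{Id}_C$; (ii) $\nu_C\circ(\mathrm{Id}_C\otimes\Delta_C)=\mathrm{Id}_C\otimes\varepsilon_C$; (iii) $\nu_C\circ(\nu_C\otimes \mathrm{Id}_{C^{\mathrm{cop}}}\otimes \mathrm{Id}_C)=\nu_C\circ(\mathrm{Id}_C\otimes \mathrm{Id}_{C^{\mathrm{cop}}}\otimes\nu_C)$;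 (iv) $\nu_C\circ(\nu_C\otimes \mathrm{Id}_{C^{\mathrm{cop}}}\otimes \mathrm{Id}_C)\circ\theta_C^{(3)}=\nu_C\circ(\mathrm{Id}_C\otimes\nu_C^{\mathrm{op}}\otimes \mathrm{Id}_C)$; (v) $\nu_C\circ(\theta_C\otimes\theta_C\otimes\theta_C)=\theta_C\circ\nu_C$. Here $\nu_C^{\mathrm{op}}:=\nu_C\circ\tau_{(13)}$, where $\tau_{(13)}$ exchanges the first and third tensor factors, and $\theta_C^{(3)}:=\mathrm{Id}_C\otimes \mathrm{Id}_{C^{\mathrm{cop}}}\otimes\theta_C\otimes \mathrm{Id}_{C^{\mathrm{cop}}}\otimes \mathrm{Id}_C$. The Hopf algebras acting on a cotorsor $C$ are the following. $H_l(C)$ is the quotient of the coalgebra $C\otimes_A C^{\mathrm{cop}}$ by the image of $$(\nu_C\otimes \mathrm{Id}_{C^{\mathrm{cop}}})\circ(\mathrm{Id}_C\otimes \mathrm{Id}_{C^{\mathrm{cop}}}\otimes\theta_C\otimes \mathrm{Id}_{C^{\mathrm{cop}}})-\mathrm{Id}_C\otimes\nu_C^{\mathrm{op}}:\;C\otimes_A C^{\mathrm{cop}}\otimes_A C\otimes_A C^{\mathrm{cop}}\to C\otimes_A C^{\mathrm{cop}},$$ with the induced coalgebra structure, product $[a\otimes b][c\otimes d]=[\nu_C(a\otimes b\otimes c)\otimes d]$, unit determined by $[\Delta_C(c)]=\varepsilon_C(c)1$, and left action on $C$ given by $[a\otimes b]\cdot c=\nu_C(a\otimes b\otimes c)$.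 $H_r(C)$ is the quotient of the coalgebra $C^{\mathrm{cop}}\otimes_A C$ by the image of $$(\mathrm{Id}_{C^{\mathrm{cop}}}\otimes\nu_C)\circ(\mathrm{Id}_{C^{\mathrm{cop}}}\otimes\theta_C\otimes \mathrm{Id}_{C^{\mathrm{cop}}}\otimes \mathrm{Id}_C)-\nu_C^{\mathrm{op}}\otimes \mathrm{Id}_C:\;C^{\mathrm{cop}}\otimes_A C\otimes_A C^{\mathrm{cop}}\otimes_A C\to C^{\mathrm{cop}}\otimes_A C,$$ with the induced coalgebra structure, product $[a\otimes b][c\otimes d]=[a\otimes\nu_C(b\otimes c\otimes d)]$, unit determined by $[\Delta_C(c)]=\varepsilon_C(c)1$, and right action on $C$ given by $c\cdot[a\otimes b]=\nu_C(c\otimes a\otimes b)$.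
   Formalization: The antipode S_H is assumed bijective; without this the claim fails, since for F = 1⊗1 one has θ_C = S_H², which is not an automorphism when S_H is not bijective, and in general θ_C is bijective exactly when S_H is. *)

(* Defs.v *)
From HB Require Import structures.
From mathcomp Require Import all_boot ssralg generic_quotient.
From mathcomp Require Import boolp classical_sets.
From mathcomp.multinomials Require Import freeg.

Set Implicit Arguments.
Unset Strict Implicit.
Unset Printing Implicit Defensive.

Import GRing.Theory.
Local Open Scope ring_scope.
Local Open Scope quotient_scope.
Local Open Scope classical_set_scope.

(* Locked, so that simplification does not unfold the linear maps built below *)
(* down to representatives of classes; use mk_linearE.                        *)
HB.lock Definition mk_linear (A : comNzRingType) (U V : lmodType A)
    (f : U -> V) (lin_f : linear f) : {linear U -> V} :=
  HB.pack f (GRing.isLinear.Build A U V *:%R f lin_f).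

Lemma mk_linearE (A : comNzRingType) (U V : lmodType A) (f : U -> V)
  (lin_f : linear f) x : mk_linear lin_f x = f x.
Proof. by rewrite mk_linear.unlock. Qed.

(* [quotmod S] is the quotient of V by the submodule generated by S; it is    *)
(* used for tensor products and for H_l(C) and H_r(C), where S is already a   *)
(* submodule, namely the image of a linear map.                               *)
Section QuotientModule.
Context (A : comNzRingType) (V : lmodType A) (S : set V).

Definition lin_span : set V := [set v | forall W : set V,
  W 0 -> (forall a u w, W u -> W w -> W (a *: u + w)) -> S `<=` W -> W v].

Lemma lin_span0 : lin_span 0.
Proof. by move=> W W0. Qed.

Lemma lin_spanP a u v : lin_span u -> lin_span v -> lin_span (a *: u + v).
Proof.
move=> Su Sv W W0 WD SW; apply: (WD a); first exact: Su.
exact: Sv.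
Qed.

Lemma lin_spanS : S `<=` lin_span.
Proof. by move=> s Ss W _ _; apply. Qed.

Lemma lin_spanD u v : lin_span u -> lin_span v -> lin_span (u + v).
Proof. by move=> Su Sv; rewrite -[u]scale1r; apply: lin_spanP. Qed.

Lemma lin_spanZ a u : lin_span u -> lin_span (a *: u).
Proof. by move=> Su; rewrite -[_ *: _]addr0; apply: lin_spanP lin_span0. Qed.

Lemma lin_spanN u : lin_span u -> lin_span (- u).
Proof. by move=> Su; rewrite -scaleN1r; apply: lin_spanZ. Qed.

Definition quot_rel (u v : V) : bool := `[< lin_span (u - v) >].

Lemma quot_rel_equiv : equiv_class_of quot_rel.
Proof.
split=> [u|u v|v u w].
- by apply/asboolP; rewrite subrr; apply: lin_span0.
- by apply/asboolP/asboolP=> /lin_spanN; rewrite opprB.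
- move=> /asboolP uv /asboolP vw; apply/asboolP.
  by rewrite -(subrK v u) -addrA; apply: lin_spanD.
Qed.

Canonical quot_equiv := EquivRelPack quot_rel_equiv.

Definition quotmod : Type := {eq_quot quot_rel}.

HB.instance Definition _ := Choice.on quotmod.

Definition quot_pi (v : V) : quotmod := \pi_{eq_quot quot_rel} v.
Definition quot_repr (x : quotmod) : V := repr (x : {eq_quot quot_rel}).

Lemma quot_reprK : cancel quot_repr quot_pi.
Proof. by move=> x; apply: reprK. Qed.

Lemma quot_piW (P : quotmod -> Prop) : (forall v, P (quot_pi v)) -> forall x, P x.
Proof. by move=> Pv x; rewrite -(quot_reprK x). Qed.

Lemma quot_piP (u v : V) : quot_pi u = quot_pi v <-> lin_span (u - v).
Proof.
split=> [/eqmodP/asboolP //|uv].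
by apply/eqmodP/asboolP.
Qed.

Lemma quot_reprP (u : V) : lin_span (quot_repr (quot_pi u) - u).
Proof. by apply/quot_piP; rewrite quot_reprK. Qed.

Definition quot_zero : quotmod := quot_pi 0.
Definition quot_opp (x : quotmod) : quotmod := quot_pi (- quot_repr x).
Definition quot_add (x y : quotmod) : quotmod :=
  quot_pi (quot_repr x + quot_repr y).
Definition quot_scale (a : A) (x : quotmod) : quotmod :=
  quot_pi (a *: quot_repr x).

Lemma quot_oppE u : quot_opp (quot_pi u) = quot_pi (- u).
Proof. by apply/quot_piP; rewrite -opprD; apply: lin_spanN; apply: quot_reprP. Qed.

Lemma quot_addE u v : quot_add (quot_pi u) (quot_pi v) = quot_pi (u + v).
Proof.
apply/quot_piP; rewrite opprD addrACA.
by apply: lin_spanD; apply: quot_reprP.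
Qed.

Lemma quot_scaleE a u : quot_scale a (quot_pi u) = quot_pi (a *: u).
Proof.
by apply/quot_piP; rewrite -scalerBr; apply: lin_spanZ; apply: quot_reprP.
Qed.

Lemma quot_addA : associative quot_add.
Proof.
elim/quot_piW=> x; elim/quot_piW=> y; elim/quot_piW=> z.
by rewrite !quot_addE addrA.
Qed.

Lemma quot_addC : commutative quot_add.
Proof. by elim/quot_piW=> x; elim/quot_piW=> y; rewrite !quot_addE addrC. Qed.

Lemma quot_add0 : left_id quot_zero quot_add.
Proof. by elim/quot_piW=> x; rewrite quot_addE add0r. Qed.

Lemma quot_addN : left_inverse quot_zero quot_opp quot_add.
Proof. by elim/quot_piW=> x; rewrite quot_oppE quot_addE addNr. Qed.

HB.instance Definition _ :=
  GRing.isZmodule.Build quotmod quot_addA quot_addC quot_add0 quot_addN.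

Lemma quot_scaleA a b x :
  quot_scale a (quot_scale b x) = quot_scale (a * b) x.
Proof. by elim/quot_piW: x => x; rewrite !quot_scaleE scalerA. Qed.

Lemma quot_scale1 : left_id 1 quot_scale.
Proof. by elim/quot_piW=> x; rewrite quot_scaleE scale1r. Qed.

Lemma quot_scaleDr : right_distributive quot_scale +%R.
Proof.
move=> a; elim/quot_piW=> x; elim/quot_piW=> y.
by rewrite -[LHS]/(quot_scale _ (quot_add _ _)) quot_addE !quot_scaleE scalerDr
  -[RHS]/(quot_add _ _) quot_addE.
Qed.

Lemma quot_scaleDl x : {morph quot_scale^~ x : a b / a + b}.
Proof.
elim/quot_piW: x => x a b.
by rewrite -[RHS]/(quot_add _ _) !quot_scaleE quot_addE scalerDl.
Qed.

HB.instance Definition _ := GRing.Zmodule_isLmodule.Build A quotmod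
  quot_scaleA quot_scale1 quot_scaleDr quot_scaleDl.

Lemma quot_class_linear : linear (quot_pi : V -> quotmod).
Proof.
move=> a u v; rewrite -[RHS]/(quot_add (quot_scale _ _) _).
by rewrite quot_scaleE quot_addE.
Qed.

Definition quot_class : {linear V -> quotmod} := mk_linear quot_class_linear.

Lemma quot_class_eqP (u v : V) :
  quot_class u = quot_class v <-> lin_span (u - v).
Proof. by rewrite !mk_linearE; apply: quot_piP. Qed.

Lemma quot_class_surj (x : quotmod) : exists v, x = quot_class v.
Proof. by exists (quot_repr x); rewrite mk_linearE quot_reprK. Qed.

Section Lift.
Context (W : lmodType A) (f : {linear V -> W}).
Hypothesis fS : forall s, S s -> f s = 0.

Lemma quot_lift_span v : lin_span v -> f v = 0.
Proof.
move=> /(_ [set u | f u = 0]); apply; first exact: linear0.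
  by move=> a u w /= fu fw; rewrite linearP fu fw scaler0 addr0.
by move=> s /fS.
Qed.

Definition quot_lift_fun (x : quotmod) : W := f (quot_repr x).

Lemma quot_lift_funE v : quot_lift_fun (quot_pi v) = f v.
Proof.
apply/eqP; rewrite -subr_eq0 -linearB; apply/eqP.
by exact: (quot_lift_span (quot_reprP v)).
Qed.

Lemma quot_lift_linear : linear quot_lift_fun.
Proof.
move=> a; elim/quot_piW=> x; elim/quot_piW=> y.
by rewrite -[a *: _ + _]/(quot_add (quot_scale _ _) _) quot_scaleE quot_addE
  !quot_lift_funE linearP.
Qed.

Definition quot_lift : {linear quotmod -> W} := mk_linear quot_lift_linear.

Lemma quot_liftE v : quot_lift (quot_class v) = f v.
Proof. by rewrite !mk_linearE; apply: quot_lift_funE. Qed.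

End Lift.
End QuotientModule.

(* The tensor product over A, as the free A-module on M x N modulo the        *)
(* bilinearity relations.                                                     *)
Section Tensor.
Context (A : comNzRingType) (M N : lmodType A).

Local Notation free := {freeg (M * N) / A}.
Local Notation gen x y := (<< 1 *g (x, y) >> : free).

Inductive bilin_rel : set free :=
| BilinL a x x' y :
    bilin_rel (gen (a *: x + x') y - (a *: gen x y + gen x' y))
| BilinR a x y y' :
    bilin_rel (gen x (a *: y + y') - (a *: gen x y + gen x y')).

Definition tensor : Type := quotmod bilin_rel.
HB.instance Definition _ := GRing.Lmodule.on tensor.

Definition tens (x : M) (y : N) : tensor := quot_class bilin_rel (gen x y).

Lemma tens_linearl y : linear (tens^~ y).
Proof.
move=> a x x'; rewrite /tens -linearP; apply/quot_class_eqP; apply: lin_spanS.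
exact: BilinL.
Qed.

Lemma tens_linearr x : linear (tens x).
Proof.
move=> a y y'; rewrite /tens -linearP; apply/quot_class_eqP; apply: lin_spanS.
exact: BilinR.
Qed.

Lemma tens_ind (P : set tensor) :
  P 0 -> (forall a t u, P t -> P u -> P (a *: t + u)) ->
  (forall x y, P (tens x y)) -> forall t, P t.
Proof.
move=> P0 PD Pt t; have [v ->] := quot_class_surj t.
rewrite -(freeg_sumE v) linear_sum.
apply: (big_ind P) => // [x y Px Py|[x y] _].
  by rewrite -[x]scale1r; apply: PD.
rewrite -[coeff _ _]mulr1.
have -> : << coeff (x, y) v * 1 *g (x, y) >> = coeff (x, y) v *: gen x y.
  by apply/eqP/freeg_eqP=> z; rewrite coeffZ !coeffU mul1r mulr1.
by rewrite linearZZ -[_ *: _]addr0; apply: PD => //; apply: Pt.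
Qed.

Lemma tens_ext (P : lmodType A) (f g : {linear tensor -> P}) :
  (forall x y, f (tens x y) = g (tens x y)) -> f =1 g.
Proof.
move=> fg; apply: (@tens_ind [set t | f t = g t]) => //=.
  by rewrite !linear0.
by move=> a t u ft fu; rewrite !linearP ft fu.
Qed.

Section Lift.
Context (P : lmodType A) (f : M -> N -> P).
Hypothesis (linl : forall y, linear (f^~ y)) (linr : forall x, linear (f x)).

Let f' (z : M * N) : P := f z.1 z.2.

Lemma fglift_linear : linear (fglift f' : free -> P).
Proof.
have fgB : {morph fglift f' : u v / u - v} by exact: lift_is_additive.
have fg0 : fglift f' (0 : free) = 0 by rewrite -(subrr 0) fgB subrr.
have fgN : {morph fglift f' : u / - u}.
  by move=> u; rewrite -sub0r fgB fg0 sub0r.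
have fgD : {morph fglift f' : u v / u + v}.
  by move=> u v; rewrite -{1}(opprK v) fgB fgN opprK.
move=> a u v; rewrite fgD; congr (_ + _).
transitivity (a *: fglift f' (\sum_(z <- dom u) << coeff z u *g z >>));
  last by rewrite freeg_sumE.
rewrite -[LHS]/(fglift f' (\sum_(z <- dom u) << a * coeff z u *g z >>)).
have fgS r (G : M * N -> free) :
    fglift f' (\sum_(z <- r) G z) = \sum_(z <- r) fglift f' (G z).
  exact: (big_morph _ fgD fg0).
rewrite !fgS scaler_sumr; apply: eq_bigr => z _.
by rewrite !liftU scalerA.
Qed.

Lemma fglift_bilin_rel s : bilin_rel s -> mk_linear fglift_linear s = 0.
Proof.
case=> [a x x' y|a x y y'];
  rewrite linearB linearP !mk_linearE !liftU !scale1r /f' /=.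
- by rewrite linl subrr.
- by rewrite linr subrr.
Qed.

Definition tlift : {linear tensor -> P} := quot_lift fglift_bilin_rel.

Lemma tliftE x y : tlift (tens x y) = f x y.
Proof. by rewrite quot_liftE mk_linearE liftU scale1r. Qed.

End Lift.
End Tensor.

Arguments tens {A M N}.

(* M ⊗ N is the module, x ⊙ y the pure tensor, f ⊠ g the tensor product of    *)
(* two linear maps; iterated tensor products associate to the left.           *)
Notation "M ⊗ N" := (tensor M N) (at level 40, left associativity) : type_scope.
Notation "x ⊙ y" := (tens x y) (at level 40, left associativity) : ring_scope.

Section TensorMaps.
Context (A : comNzRingType).
Implicit Types M N P Q : lmodType A.

Definition idl M : {linear M -> M} := idfun.

Section Map.
Context M N P Q (f : {linear M -> P}) (g : {linear N -> Q}).

Lemma tmap_linearl y : linear (fun x => f x ⊙ g y).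
Proof. by move=> a x x'; rewrite linearP tens_linearl. Qed.

Lemma tmap_linearr x : linear (fun y => f x ⊙ g y).
Proof. by move=> a y y'; rewrite linearP tens_linearr. Qed.

Definition tmap : {linear M ⊗ N -> P ⊗ Q} := tlift tmap_linearl tmap_linearr.

Lemma tmapE x y : tmap (x ⊙ y) = f x ⊙ g y.
Proof. exact: tliftE. Qed.

End Map.

Section Swap.
Context M N.

Lemma tswap_linearl (y : N) : linear (fun x : M => y ⊙ x).
Proof. exact: tens_linearr. Qed.

Lemma tswap_linearr (x : M) : linear (fun y : N => y ⊙ x).
Proof. exact: tens_linearl. Qed.

Definition tswap : {linear M ⊗ N -> N ⊗ M} :=
  tlift tswap_linearl tswap_linearr.

Lemma tswapE x y : tswap (x ⊙ y) = y ⊙ x.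
Proof. exact: tliftE. Qed.

End Swap.

Section Unit.
Context M.

Lemma tlunit_linearl (x : M) : linear (fun a : A^o => (a : A) *: x).
Proof. by move=> b a a' /=; rewrite scalerDl scalerA. Qed.

Lemma tlunit_linearr (a : A^o) : linear (fun x : M => (a : A) *: x).
Proof. by move=> b x x' /=; rewrite scalerDr !scalerA mulrC. Qed.

Definition tlunit : {linear A^o ⊗ M -> M} :=
  tlift tlunit_linearl tlunit_linearr.

Lemma tlunitE (a : A^o) x : tlunit (a ⊙ x) = (a : A) *: x.
Proof. exact: tliftE. Qed.

Definition trunit : {linear M ⊗ A^o -> M} := tlunit \o tswap M A^o.

Lemma trunitE x (a : A^o) : trunit (x ⊙ a) = (a : A) *: x.
Proof. by rewrite -tlunitE -(tswapE x a). Qed.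

End Unit.

Definition tensr_lin N P (z : P) : {linear N -> N ⊗ P} :=
  mk_linear (tens_linearl z).
Definition tensl_lin M N (x : M) : {linear N -> M ⊗ N} :=
  mk_linear (tens_linearr x).

Section Assoc.
Context M N P.

Lemma tassocr_linearl (z : P) :
  linear (fun t : M ⊗ N => tmap (idl M) (tensr_lin N z) t).
Proof. exact: linearP. Qed.

Lemma tassocr_linearr (t : M ⊗ N) :
  linear (fun z : P => tmap (idl M) (tensr_lin N z) t).
Proof.
move=> a z z'; move: t.
apply: tens_ind => [|b t u /= Et Eu|x y].
- by rewrite !linear0 addr0.
- rewrite !(linearP (tmap _ _)) Et Eu !scalerDr !scalerA (mulrC b).
  by rewrite -!addrA; congr (_ + _); rewrite addrCA.
- by rewrite !tmapE !mk_linearE !tens_linearr.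
Qed.

Definition tassocr : {linear M ⊗ N ⊗ P -> M ⊗ (N ⊗ P)} :=
  tlift tassocr_linearl tassocr_linearr.

Lemma tassocrE x y z : tassocr (x ⊙ y ⊙ z) = x ⊙ (y ⊙ z).
Proof. by rewrite tliftE tmapE mk_linearE. Qed.

Lemma tassocl_linearl (u : N ⊗ P) :
  linear (fun x : M => tmap (tensl_lin N x) (idl P) u).
Proof.
move=> a x x'; move: u.
apply: tens_ind => [|b t u /= Et Eu|y z].
- by rewrite !linear0 addr0.
- rewrite !(linearP (tmap _ _)) Et Eu !scalerDr !scalerA (mulrC b).
  by rewrite -!addrA; congr (_ + _); rewrite addrCA.
- by rewrite !tmapE !mk_linearE !tens_linearl.
Qed.

Lemma tassocl_linearr (x : M) :
  linear (fun u : N ⊗ P => tmap (tensl_lin N x) (idl P) u).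
Proof. exact: linearP. Qed.

Definition tassocl : {linear M ⊗ (N ⊗ P) -> M ⊗ N ⊗ P} :=
  tlift tassocl_linearl tassocl_linearr.

Lemma tassoclE x y z : tassocl (x ⊙ (y ⊙ z)) = x ⊙ y ⊙ z.
Proof. by rewrite tliftE tmapE mk_linearE. Qed.

End Assoc.
End TensorMaps.

Arguments idl {A M}.
Arguments tswap {A M N}.
Arguments tlunit {A M}.
Arguments trunit {A M}.
Arguments tassocl {A M N P}.
Arguments tassocr {A M N P}.

Notation "f ⊠ g" := (tmap f g) (at level 40, left associativity) : ring_scope.

Section Rearrangements.
Context (A : comNzRingType).
Implicit Types M N P Q : lmodType A.

(* x ⊗ y ⊗ z ⊗ t |-> x ⊗ (y ⊗ z ⊗ t) *)
Definition tassoc4 M N P Q : {linear M ⊗ N ⊗ P ⊗ Q -> M ⊗ (N ⊗ P ⊗ Q)} :=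
  tassocr \o (tassocr ⊠ idl).

Lemma tassoc4E M N P Q (x : M) (y : N) (z : P) (t : Q) :
  tassoc4 M N P Q (x ⊙ y ⊙ z ⊙ t) = x ⊙ (y ⊙ z ⊙ t).
Proof. by rewrite /tassoc4 /= tmapE !tassocrE. Qed.

(* (x ⊗ y) ⊗ (z ⊗ t) |-> (x ⊗ z) ⊗ (y ⊗ t) *)
Definition tinterchange M N P Q :
    {linear M ⊗ N ⊗ (P ⊗ Q) -> M ⊗ P ⊗ (N ⊗ Q)} :=
  tassocl \o (idl ⊠ (tassocr \o (tswap ⊠ idl) \o tassocl)) \o tassocr.

Lemma tinterchangeE M N P Q (x : M) (y : N) (z : P) (t : Q) :
  tinterchange M N P Q (x ⊙ y ⊙ (z ⊙ t)) = x ⊙ z ⊙ (y ⊙ t).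
Proof.
by rewrite /tinterchange /= tassocrE tmapE /= tassoclE tmapE tswapE tassocrE
  tassoclE.
Qed.

(* x ⊗ y ⊗ z |-> z ⊗ y ⊗ x *)
Definition tswap13 M N P : {linear M ⊗ N ⊗ P -> P ⊗ N ⊗ M} :=
  tassocl \o (idl ⊠ tswap) \o tswap.

Lemma tswap13E M N P (x : M) (y : N) (z : P) :
  tswap13 M N P (x ⊙ y ⊙ z) = z ⊙ y ⊙ x.
Proof. by rewrite /tswap13 /= tswapE tmapE tswapE tassoclE. Qed.

End Rearrangements.

Arguments tassoc4 {A M N P Q}.
Arguments tinterchange {A M N P Q}.
Arguments tswap13 {A M N P}.

Section Structures.
Context (A : comNzRingType).
Implicit Types M N : lmodType A.

Record alg M := Alg {
  amul : {linear M ⊗ M -> M};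
  aone : M }.

Record coalg M := Coalg {
  comul : {linear M -> M ⊗ M};
  counit : {linear M -> A^o} }.

Record hopf M := Hopf {
  hopf_alg :> alg M;
  hopf_coalg :> coalg M;
  antipode : {linear M -> M} }.

Definition tens_alg M N (a : alg M) (b : alg N) : alg (M ⊗ N) :=
  Alg ((amul a ⊠ amul b) \o tinterchange) (aone a ⊙ aone b).

Definition tens_coalg M N (c : coalg M) (d : coalg N) : coalg (M ⊗ N) :=
  Coalg (tinterchange \o (comul c ⊠ comul d))
        (tlunit \o (counit c ⊠ counit d)).

Definition cop M (c : coalg M) : coalg M :=
  Coalg (tswap \o comul c) (counit c).

Definition is_inverse M (a : alg M) (x y : M) : Prop :=
  amul a (x ⊙ y) = aone a /\ amul a (y ⊙ x) = aone a.

Definition invertible M (a : alg M) (x : M) : Prop :=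
  exists y, is_inverse a x y.

(* 0 if x is not invertible *)
Definition ainv M (a : alg M) (x : M) : M := xget 0 (is_inverse a x).

Record is_alg M (a : alg M) : Prop := IsAlg {
  alg_assoc : forall x y z,
    amul a (amul a (x ⊙ y) ⊙ z) = amul a (x ⊙ amul a (y ⊙ z));
  alg_mul1l : forall x, amul a (aone a ⊙ x) = x;
  alg_mul1r : forall x, amul a (x ⊙ aone a) = x }.

Record is_coalg M (c : coalg M) : Prop := IsCoalg {
  coalg_coassoc : tassocr \o (comul c ⊠ idl) \o comul c
    =1 (idl ⊠ comul c) \o comul c;
  coalg_counitl : tlunit \o (counit c ⊠ idl) \o comul c =1 idfun;
  coalg_counitr : trunit \o (idl ⊠ counit c) \o comul c =1 idfun }.

Record alg_morph M N (a : alg M) (b : alg N) (f : {linear M -> N}) : Prop :=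
  AlgMorph {
  alg_morph_mul : f \o amul a =1 amul b \o (f ⊠ f);
  alg_morph_one : f (aone a) = aone b }.

Record coalg_morph M N (c : coalg M) (d : coalg N) (f : {linear M -> N}) :
    Prop := CoalgMorph {
  coalg_morph_comul : (f ⊠ f) \o comul c =1 comul d \o f;
  coalg_morph_counit : counit d \o f =1 counit c }.

Definition coalg_aut M (c : coalg M) (f : {linear M -> M}) : Prop :=
  coalg_morph c c f /\ bijective f.

Definition ground_alg : alg A^o := Alg tlunit (1 : A).

Record is_hopf M (h : hopf M) : Prop := IsHopf {
  hopf_is_alg : is_alg h;
  hopf_is_coalg : is_coalg h;
  hopf_comul_morph : alg_morph h (tens_alg h h) (comul h);
  hopf_counit_morph : alg_morph h ground_alg (counit h);
  hopf_antipodel : forall x,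
    amul h ((antipode h ⊠ idl) (comul h x)) = (counit h x : A) *: aone h;
  hopf_antipoder : forall x,
    amul h ((idl ⊠ antipode h) (comul h x)) = (counit h x : A) *: aone h }.

Definition hopf_iso M N (g : hopf M) (h : hopf N) (f : {linear M -> N}) : Prop :=
  [/\ bijective f, alg_morph g h f, coalg_morph g h f &
      f \o antipode g =1 antipode h \o f].

Definition hopf_isomorphic M N (g : hopf M) (h : hopf N) : Prop :=
  exists f : {linear M -> N}, hopf_iso g h f.

Definition is_left_action M N (a : alg M) (act : {linear M ⊗ N -> N}) : Prop :=
  (forall x, act (aone a ⊙ x) = x) /\
  (forall g h x, act (amul a (g ⊙ h) ⊙ x) = act (g ⊙ act (h ⊙ x))).

Definition is_right_action M N (a : alg M) (act : {linear N ⊗ M -> N}) : Prop :=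
  (forall x, act (x ⊙ aone a) = x) /\
  (forall x g h, act (x ⊙ amul a (g ⊙ h)) = act (act (x ⊙ g) ⊙ h)).

End Structures.

Section Cotorsors.
Context (A : comNzRingType) (C : lmodType A).

Record cotorsor := Cotorsor {
  ct_coalg :> coalg C;
  ct_nu : {linear C ⊗ C ⊗ C -> C};
  ct_theta : {linear C -> C} }.

Context (T : cotorsor).
Local Notation nu := (ct_nu T).
Local Notation theta := (ct_theta T).
Local Notation Delta := (comul T).
Local Notation eps := (counit T).

Definition ct_nu_op : {linear C ⊗ C ⊗ C -> C} := nu \o tswap13.

Record is_cotorsor : Prop := IsCotorsor {
  ct_is_coalg : is_coalg T;
  ct_nu_morph : coalg_morph (tens_coalg (tens_coalg T (cop T)) T) T nu;
  ct_theta_aut : coalg_aut T theta;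
  ct_axiom1 : nu \o (Delta ⊠ idl) =1 tlunit \o (eps ⊠ idl);
  ct_axiom2 : nu \o tassocl \o (idl ⊠ Delta) =1 trunit \o (idl ⊠ eps);
  ct_axiom3 : nu \o (nu ⊠ idl ⊠ idl) =1 nu \o (idl ⊠ nu) \o tassoc4;
  ct_axiom4 : nu \o (nu ⊠ idl ⊠ idl) \o (idl ⊠ idl ⊠ theta ⊠ idl ⊠ idl)
    =1 nu \o (idl ⊠ ct_nu_op ⊠ idl) \o (tassoc4 ⊠ idl);
  ct_axiom5 : nu \o (theta ⊠ theta ⊠ theta) =1 theta \o nu }.

Definition Hl_rel : {linear C ⊗ C ⊗ C ⊗ C -> C ⊗ C} :=
  ((nu ⊠ idl) \o (idl ⊠ idl ⊠ theta ⊠ idl)) \- ((idl ⊠ ct_nu_op) \o tassoc4).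

Definition Hl : Type := quotmod (range Hl_rel).
HB.instance Definition _ := GRing.Lmodule.on Hl.

Definition Hl_class : {linear C ⊗ C -> Hl} := quot_class (range Hl_rel).

Definition Hr_rel : {linear C ⊗ C ⊗ C ⊗ C -> C ⊗ C} :=
  ((idl ⊠ nu) \o tassoc4 \o (idl ⊠ theta ⊠ idl ⊠ idl)) \- (ct_nu_op ⊠ idl).

Definition Hr : Type := quotmod (range Hr_rel).
HB.instance Definition _ := GRing.Lmodule.on Hr.

Definition Hr_class : {linear C ⊗ C -> Hr} := quot_class (range Hr_rel).

(* X is the Hopf algebra structure of H_l(C).  There is at most one: the      *)
(* classes of pure tensors span H_l(C), and units and antipodes are unique.   *)
Record is_Hl (X : hopf Hl) : Prop := IsHl {
  Hl_is_hopf : is_hopf X;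
  Hl_coalg : coalg_morph (tens_coalg T (cop T)) X Hl_class;
  Hl_mul : forall a b c d,
    amul X (Hl_class (a ⊙ b) ⊙ Hl_class (c ⊙ d)) =
    Hl_class (nu (a ⊙ b ⊙ c) ⊙ d);
  Hl_one : forall c, Hl_class (Delta c) = (eps c : A) *: aone X;
  Hl_action : exists2 act : {linear Hl ⊗ C -> C}, is_left_action X act &
    forall a b c, act (Hl_class (a ⊙ b) ⊙ c) = nu (a ⊙ b ⊙ c) }.

Record is_Hr (X : hopf Hr) : Prop := IsHr {
  Hr_is_hopf : is_hopf X;
  Hr_coalg : coalg_morph (tens_coalg (cop T) T) X Hr_class;
  Hr_mul : forall a b c d,
    amul X (Hr_class (a ⊙ b) ⊙ Hr_class (c ⊙ d)) =
    Hr_class (a ⊙ nu (b ⊙ c ⊙ d));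
  Hr_one : forall c, Hr_class (Delta c) = (eps c : A) *: aone X;
  Hr_action : exists2 act : {linear C ⊗ Hr -> C}, is_right_action X act &
    forall a b c, act (c ⊙ Hr_class (a ⊙ b)) = nu (c ⊙ a ⊙ b) }.

End Cotorsors.

Section DrinfeldTwist.
Context (A : comNzRingType) (M : lmodType A) (h : hopf M).

Record is_twist (F : M ⊗ M) : Prop := IsTwist {
  twist_invertible : invertible (tens_alg h h) F;
  twist_cocycle :
    amul (tens_alg (tens_alg h h) h)
      ((F ⊙ aone h) ⊙ (comul h ⊠ idl) F) =
    amul (tens_alg (tens_alg h h) h)
      (tassocl (aone h ⊙ F) ⊙ tassocl ((idl ⊠ comul h) F));
  twist_counitl : tlunit ((counit h ⊠ idl) F) = aone h;
  twist_counitr : trunit ((idl ⊠ counit h) F) = aone h }.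

End DrinfeldTwist.

Section AlgebraStructure.
Context (A : comNzRingType) (H : algType A).

Lemma alg_mul_linearl (y : H) : linear (fun x : H => x * y).
Proof. by move=> a x x'; rewrite mulrDl scalerAl. Qed.

Lemma alg_mul_linearr (x : H) : linear (fun y : H => x * y).
Proof. by move=> a y y'; rewrite mulrDr scalerAr. Qed.

Definition alg_of : alg H := Alg (tlift alg_mul_linearl alg_mul_linearr) 1.

Lemma alg_ofE x y : amul alg_of (x ⊙ y) = x * y.
Proof. exact: tliftE. Qed.

End AlgebraStructure.

(* For a twist F of the Hopf algebra (H, *, Delta, 1, eps, S): the element    *)
(* u_F, the Hopf algebra H_F, and Delta_C, theta_C and nu_C on C = H.  Here   *)
(* F^-1 and u_F^-1 are the inverses of F and u_F when they exist (F is        *)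
(* invertible by the definition of a twist).                                  *)
Section TwistCotorsor.
Context (A : comNzRingType) (H : algType A).
Context (Delta : {linear H -> H ⊗ H}) (eps : {linear H -> A^o}).
Context (S : {linear H -> H}) (F : H ⊗ H).

Definition hopf_of : hopf H := Hopf (alg_of H) (Coalg Delta eps) S.

Local Notation HH := (tens_alg (alg_of H) (alg_of H)).

Definition twist_inv : H ⊗ H := ainv HH F.

Definition twist_u : H := amul (alg_of H) ((idl ⊠ S) F).
Definition twist_u_inv : H := ainv (alg_of H) twist_u.

Local Notation u := twist_u.
Local Notation u' := twist_u_inv.

Lemma twist_comul_linear :
  linear (fun x => amul HH (amul HH (F ⊙ Delta x) ⊙ twist_inv)).
Proof.
by move=> a x y; rewrite linearP tens_linearr linearP tens_linearl linearP.
Qed.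

Lemma twist_antipode_linear : linear (fun x => u * S x * u').
Proof.
by move=> a x y; rewrite linearP mulrDr mulrDl -scalerAr -scalerAl.
Qed.

Definition hopf_twist : hopf H :=
  Hopf (alg_of H) (Coalg (mk_linear twist_comul_linear) eps)
       (mk_linear twist_antipode_linear).

Lemma twist_comul_C_linear :
  linear (fun x => amul HH (Delta x ⊙ twist_inv)).
Proof. by move=> a x y; rewrite linearP tens_linearl linearP. Qed.

Definition twist_coalg_C : coalg H := Coalg (mk_linear twist_comul_C_linear) eps.

Lemma twist_theta_linear : linear (fun x => S (S x) * S u * u').
Proof. by move=> a x y; rewrite !linearP !mulrDl -!scalerAl. Qed.

Definition twist_theta : {linear H -> H} := mk_linear twist_theta_linear.

Lemma twist_xuSy_linearl (y : H) : linear (fun x : H => x * u * S y).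
Proof. by move=> a x x'; rewrite !mulrDl -!scalerAl. Qed.

Lemma twist_xuSy_linearr (x : H) : linear (fun y : H => x * u * S y).
Proof. by move=> a y y'; rewrite linearP mulrDr -scalerAr. Qed.

Definition twist_xuSy : {linear H ⊗ H -> H} :=
  tlift twist_xuSy_linearl twist_xuSy_linearr.

Lemma twist_nu_linearl (z : H) : linear (fun t : H ⊗ H => twist_xuSy t * z).
Proof. by move=> a t t'; rewrite linearP mulrDl -scalerAl. Qed.

Lemma twist_nu_linearr (t : H ⊗ H) : linear (fun z : H => twist_xuSy t * z).
Proof. by move=> a z z'; rewrite mulrDr -scalerAr. Qed.

Definition twist_nu : {linear H ⊗ H ⊗ H -> H} :=
  tlift twist_nu_linearl twist_nu_linearr.

Lemma twist_nuE x y z : twist_nu (x ⊙ y ⊙ z) = x * u * S y * z.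
Proof. by rewrite tliftE tliftE. Qed.

End TwistCotorsor.

(* Main.v *)
Require Import Defs.
From mathcomp Require Import all_boot ssralg.
From mathcomp Require Import classical_sets.

Set Implicit Arguments.
Unset Strict Implicit.
Unset Printing Implicit Defensive.

Import GRing.Theory.
Local Open Scope ring_scope.

(** The map beta(x) = u_F S(x) is the inverse of the identity of H in the
    convolution algebra Hom(C, H).  Hence x |-> Delta(beta(x)) and
    x |-> F^-1 (beta ⊗ beta)(Delta_C^op(x)) are both inverse to Delta in
    Hom(C, H ⊗ H), so they coincide; this one identity contains the formula
    Delta(u_F) = F^-1 (u_F ⊗ u_F)(S ⊗ S)(F_21^-1) and the compatibility of
    S with Delta, from which nu_C and theta_C are coalgebra morphisms.  The
    maps a ⊗ b |-> a beta(b) and a ⊗ b |-> beta(a) b have the defining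
    submodules of H_l(C) and H_r(C) as kernels, and carry the structures of
    H_l(C) and H_r(C) to those of H and H_F. *)

(* Otherwise [/=] unfolds these maps into composites on which their values on
   pure tensors (tinterchangeE, tassoc4E, ...) no longer apply. *)
Opaque idl trunit tinterchange tassoc4 tswap13.

(** * Linear identities checked on pure tensors *)

Section TensorExtensionality.
Context (A : comNzRingType).
Implicit Types M N P Q : lmodType A.

Lemma tensPl M N a (x x' : M) (y : N) :
  (a *: x + x') ⊙ y = a *: (x ⊙ y) + x' ⊙ y.
Proof. exact: tens_linearl. Qed.

Lemma tensPr M N a (x : M) (y y' : N) :
  x ⊙ (a *: y + y') = a *: (x ⊙ y) + x ⊙ y'.
Proof. exact: tens_linearr. Qed.

Lemma tensZl M N a (x : M) (y : N) : (a *: x) ⊙ y = a *: (x ⊙ y).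
Proof. by have := linearZZ (tensr_lin M y) a x; rewrite !mk_linearE. Qed.

Lemma tensZr M N a (x : M) (y : N) : x ⊙ (a *: y) = a *: (x ⊙ y).
Proof. by have := linearZZ (tensl_lin N x) a y; rewrite !mk_linearE. Qed.

Lemma mulrPl (R : algType A) a (x x' y : R) :
  (a *: x + x') * y = a *: (x * y) + x' * y.
Proof. by rewrite mulrDl scalerAl. Qed.

Lemma mulrPr (R : algType A) a (x y y' : R) :
  x * (a *: y + y') = a *: (x * y) + x * y'.
Proof. by rewrite mulrDr scalerAr. Qed.

Lemma scalePl M a (b c : A^o) (x : M) :
  (a *: b + c : A) *: x = a *: ((b : A) *: x) + (c : A) *: x.
Proof. by rewrite scalerDl scalerA. Qed.

(** [f] and [g] are bare functions, so that unification can read the two sides of an equation as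
    functions of one tensor. *)
Lemma tens_eq M N P (f g : M ⊗ N -> P) : linear f -> linear g ->
  (forall x y, f (x ⊙ y) = g (x ⊙ y)) -> f =1 g.
Proof.
move=> lin_f lin_g fg t; have := tens_ext (f := mk_linear lin_f)
  (g := mk_linear lin_g).
by move=> /(_ _ t); rewrite !mk_linearE; apply=> x y; rewrite !mk_linearE.
Qed.

Lemma idlE M (x : M) : (idl : {linear M -> M}) x = x.
Proof. exact: erefl. Qed.

End TensorExtensionality.

Ltac lin_tac :=
  move=> ? ? ? /=;
  by rewrite
    ?(tensPl, tensPr, mulrPl, mulrPr, scalePl, linearP, scaler0, addr0).

(* Replaces a tensor in an equation by a pure one; both sides must be linear in it, which [lin_tac]
   checks. *)
Tactic Notation "tens_elim" ident(t) simple_intropattern(x)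
    simple_intropattern(y) :=
  move: t; refine (tens_eq _ _ _); [lin_tac | lin_tac | intros x y].

(** * Tensor products of algebras and of coalgebras; convolution inverses *)

Section TensorStructures.
Context (A : comNzRingType).
Implicit Types M N P Q : lmodType A.

Lemma tassocrK M N P : cancel (@tassocr A M N P) tassocl.
Proof.
move=> t; tens_elim t s z; tens_elim s x y.
by rewrite tassocrE tassoclE.
Qed.

Lemma tassoclK M N P : cancel (@tassocl A M N P) tassocr.
Proof.
move=> t; tens_elim t x s; tens_elim s y z.
by rewrite tassoclE tassocrE.
Qed.

Section TensAlg.
Context M N (a : alg M) (b : alg N).

Lemma tens_amulE x y z t :
  amul (tens_alg a b) ((x ⊙ y) ⊙ (z ⊙ t)) = amul a (x ⊙ z) ⊙ amul b (y ⊙ t).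
Proof. by rewrite /= tinterchangeE tmapE. Qed.

Lemma tens_is_alg : is_alg a -> is_alg b -> is_alg (tens_alg a b).
Proof.
move=> Ha Hb; split.
- move=> x y z; tens_elim x x1 x2; tens_elim y y1 y2; tens_elim z z1 z2.
  by rewrite !tens_amulE !alg_assoc.
- by move=> x; tens_elim x x1 x2; rewrite tens_amulE !alg_mul1l.
- by move=> x; tens_elim x x1 x2; rewrite tens_amulE !alg_mul1r.
Qed.

End TensAlg.

Section TensCoalg.
Context M N (c : coalg M) (d : coalg N).

Lemma tens_is_coalg : is_coalg c -> is_coalg d -> is_coalg (tens_coalg c d).
Proof.
move=> Hc Hd; split.
- move=> t /=; tens_elim t x y; rewrite tmapE.
  (* [L] sorts a pair of triple tensors into a triple of pairs; it carries the coassociativity of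
     [c] and [d] to that of the tensor coalgebra. *)
  pose L : {linear M ⊗ (M ⊗ M) ⊗ (N ⊗ (N ⊗ N)) ->
      (M ⊗ N) ⊗ ((M ⊗ N) ⊗ (M ⊗ N))} := (idl ⊠ tinterchange) \o tinterchange.
  transitivity (L ((tassocr \o (comul c ⊠ idl) \o comul c) x ⊙
      (tassocr \o (comul d ⊠ idl) \o comul d) y)).
    rewrite /=; move: (comul c x) (comul d y) => t s.
    tens_elim t x1 x2; tens_elim s y1 y2.
    rewrite tinterchangeE !tmapE /= tmapE !idlE.
    move: (comul c x1) (comul d y1) => t s.
    tens_elim t x3 x4; tens_elim s y3 y4.
    by rewrite tinterchangeE !tassocrE tinterchangeE tmapE tinterchangeE.
  rewrite (coalg_coassoc Hc) (coalg_coassoc Hd) /=.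
  move: (comul c x) (comul d y) => t s.
  tens_elim t x1 x2; tens_elim s y1 y2.
  by rewrite !tinterchangeE !tmapE /= !idlE tmapE tinterchangeE tmapE idlE.
- move=> t /=; tens_elim t x y; rewrite tmapE.
  transitivity ((tlunit \o (counit c ⊠ idl) \o comul c) x ⊙
     (tlunit \o (counit d ⊠ idl) \o comul d) y);
    last by rewrite (coalg_counitl Hc) (coalg_counitl Hd).
  rewrite /=; move: (comul c x) (comul d y) => t s.
  tens_elim t x1 x2; tens_elim s y1 y2.
  by rewrite tinterchangeE !tmapE /= tmapE !tlunitE !idlE tensZl tensZr scalerA.
- move=> t /=; tens_elim t x y; rewrite tmapE.
  transitivity ((trunit \o (idl ⊠ counit c) \o comul c) x ⊙
     (trunit \o (idl ⊠ counit d) \o comul d) y);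
    last by rewrite (coalg_counitr Hc) (coalg_counitr Hd).
  rewrite /=; move: (comul c x) (comul d y) => t s.
  tens_elim t x1 x2; tens_elim s y1 y2.
  by rewrite tinterchangeE !tmapE /= tmapE !trunitE tlunitE !idlE tensZl tensZr
    scalerA.
Qed.

End TensCoalg.

Lemma coassocE M (c : coalg M) x : is_coalg c ->
  tassocr ((comul c ⊠ idl) (comul c x)) = (idl ⊠ comul c) (comul c x).
Proof. by move=> Hc; exact: coalg_coassoc Hc x. Qed.

Lemma counitlE M (c : coalg M) x : is_coalg c ->
  tlunit ((counit c ⊠ idl) (comul c x)) = x.
Proof. by move=> Hc; exact: coalg_counitl Hc x. Qed.

Lemma counitrE M (c : coalg M) x : is_coalg c ->
  trunit ((idl ⊠ counit c) (comul c x)) = x.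
Proof. by move=> Hc; exact: coalg_counitr Hc x. Qed.

(** In the convolution algebra, [f = f(gh) = (fg)h = h]. *)
Lemma convolution_inverse_uniq C B (c : coalg C) (b : alg B)
    (f g h : {linear C -> B}) : is_coalg c -> is_alg b ->
  (forall x, amul b ((f ⊠ g) (comul c x)) = (counit c x : A) *: aone b) ->
  (forall x, amul b ((g ⊠ h) (comul c x)) = (counit c x : A) *: aone b) ->
  f =1 h.
Proof.
move=> Hc Hb fg gh x.
(* [L] multiplies out [f(x_1) (g(x_2) h(x_3))]; coassociativity lets either inner product collapse
   to the counit. *)
pose L := amul b \o (idl ⊠ amul b) \o (f ⊠ (g ⊠ h)).
transitivity (L ((idl ⊠ comul c) (comul c x))).
  rewrite -{1}(counitrE x Hc) /L /=.
  move: (comul c x) => t; tens_elim t x1 x2.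
  by rewrite !tmapE gh idlE trunitE !linearZZ /= tensZr linearZZ alg_mul1r.
rewrite -coassocE // -{2}(counitlE x Hc) /L /=.
move: (comul c x) => t; tens_elim t x1 x2.
rewrite !tmapE idlE tlunitE linearZZ.
rewrite -[h x2 in RHS](alg_mul1l Hb) -linearZZ -tensZl -fg.
move: (comul c x1) => t; tens_elim t x3 x4.
by rewrite tassocrE !tmapE alg_assoc.
Qed.

End TensorStructures.

Opaque tens_alg alg_of.

(** * Multiplication in [H ⊗ H] and [H ⊗ H ⊗ H] *)

Section AlgOf.
Context (A : comNzRingType) (H : algType A).

Lemma alg_of_is_alg : is_alg (alg_of H).
Proof.
by split=> [x y z|x|x]; rewrite !alg_ofE ?mulrA ?mul1r ?mulr1.
Qed.

Lemma aone_alg_of : aone (alg_of H) = 1.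
Proof. exact: erefl. Qed.

Lemma aone_tens M N (a : alg M) (b : alg N) :
  aone (tens_alg (A := A) a b) = aone a ⊙ aone b.
Proof. exact: erefl. Qed.

Notation HH := (tens_alg (alg_of H) (alg_of H)).
Notation HHH := (tens_alg HH (alg_of H)).

Lemma HH_is_alg : is_alg HH.
Proof. exact: tens_is_alg alg_of_is_alg alg_of_is_alg. Qed.

Lemma HHH_is_alg : is_alg HHH.
Proof. exact: tens_is_alg HH_is_alg alg_of_is_alg. Qed.

Lemma HHE (a b c d : H) : amul HH (a ⊙ b ⊙ (c ⊙ d)) = (a * c) ⊙ (b * d).
Proof. by rewrite tens_amulE !alg_ofE. Qed.

Lemma HHHE (s t : H ⊗ H) (c d : H) :
  amul HHH (s ⊙ c ⊙ (t ⊙ d)) = amul HH (s ⊙ t) ⊙ (c * d).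
Proof. by rewrite tens_amulE !alg_ofE. Qed.

End AlgOf.

Arguments HH_is_alg {A H}.
Arguments HHH_is_alg {A H}.
Local Notation HH H := (tens_alg (alg_of H) (alg_of H)).
Local Notation HHH H := (tens_alg (HH H) (alg_of H)).
Local Notation "s ∗ t" := (amul (HH _) (s ⊙ t))
  (at level 40, left associativity)
  : ring_scope.
Local Notation "s ∗∗ t" := (amul (HHH _) (s ⊙ t))
  (at level 40, left associativity)
  : ring_scope.

(** * Hopf algebra identities *)

Section Antipode.
Context (A : comNzRingType) (H : algType A).
Context (Delta : {linear H -> H ⊗ H}) (eps : {linear H -> A^o}).
Context (S : {linear H -> H}).
Hypothesis H_hopf : is_hopf (hopf_of Delta eps S).

Local Notation mm := (amul (alg_of H)).

Lemma HH1l (t : H ⊗ H) : (1 ⊙ 1) ∗ t = t.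
Proof. exact: alg_mul1l HH_is_alg t. Qed.

Lemma HH1r (t : H ⊗ H) : t ∗ (1 ⊙ 1) = t.
Proof. exact: alg_mul1r HH_is_alg t. Qed.

Lemma HHA (r s t : H ⊗ H) : r ∗ (s ∗ t) = r ∗ s ∗ t.
Proof. exact/esym/(alg_assoc HH_is_alg). Qed.

Let DeltaC : coalg H := Coalg Delta eps.

Lemma comul_is_coalg : is_coalg DeltaC.
Proof. exact: hopf_is_coalg H_hopf. Qed.

Lemma comul_coassoc x :
  tassocr ((Delta ⊠ idl) (Delta x)) = (idl ⊠ Delta) (Delta x).
Proof. exact: (coassocE x comul_is_coalg). Qed.

Lemma comul_counitl x : tlunit ((eps ⊠ idl) (Delta x)) = x.
Proof. exact: (counitlE x comul_is_coalg). Qed.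

Lemma comul_counitr x : trunit ((idl ⊠ eps) (Delta x)) = x.
Proof. exact: (counitrE x comul_is_coalg). Qed.

Lemma comulM x y : Delta (x * y) = Delta x ∗ Delta y.
Proof.
by have := alg_morph_mul (hopf_comul_morph H_hopf) (x ⊙ y);
  rewrite /= tmapE alg_ofE.
Qed.

Lemma comul1 : Delta 1 = 1 ⊙ 1.
Proof. exact: alg_morph_one (hopf_comul_morph H_hopf). Qed.

Lemma counitM x y : eps (x * y) = (eps x : A) * eps y.
Proof.
have := alg_morph_mul (hopf_counit_morph H_hopf) (x ⊙ y).
by rewrite /= tmapE alg_ofE tlunitE.
Qed.

Lemma counit1 : eps 1 = 1.
Proof. exact: alg_morph_one (hopf_counit_morph H_hopf). Qed.

Lemma antipodel x : mm ((S ⊠ idl) (Delta x)) = (eps x : A) *: 1.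
Proof. exact: hopf_antipodel H_hopf x. Qed.

Lemma antipoder x : mm ((idl ⊠ S) (Delta x)) = (eps x : A) *: 1.
Proof. exact: hopf_antipoder H_hopf x. Qed.

Lemma antipode1 : S 1 = 1.
Proof.
by have := antipodel 1; rewrite comul1 tmapE alg_ofE idlE mulr1 counit1 scale1r.
Qed.

(** Both sides, as maps on [H ⊗ H], are convolution inverse to the multiplication: the left one by
    the antipode axiom at [x y], the right one by the axiom at [y] and then at [x]. *)
Lemma antipodeM x y : S (x * y) = S y * S x.
Proof.
suff: S \o mm =1 mm \o (S ⊠ S) \o tswap.
  by move=> /(_ (x ⊙ y)) /=; rewrite tswapE tmapE !alg_ofE.
apply: (@convolution_inverse_uniq _ _ _ (tens_coalg DeltaC DeltaC)
  (alg_of H) _ mm); first exact: tens_is_coalg comul_is_coalg comul_is_coalg.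
- exact: alg_of_is_alg.
- move=> {x y} t; tens_elim t x y; rewrite /= !tmapE tlunitE aone_alg_of.
  transitivity (mm ((S ⊠ idl) (Delta (x * y)))).
    rewrite comulM; congr (mm _); move: (Delta x) (Delta y) => t s.
    tens_elim t a b; tens_elim s c d.
    by rewrite tinterchangeE HHE !tmapE /= !alg_ofE.
  by rewrite antipodel counitM.
- move=> {x y} t; tens_elim t x y; rewrite /= !tmapE tlunitE aone_alg_of.
  transitivity ((eps y : A) *: mm ((idl ⊠ S) (Delta x))).
    move: (Delta x) => t; tens_elim t a b; rewrite tmapE alg_ofE idlE.
    transitivity (a * mm ((idl ⊠ S) (Delta y)) * S b).
      move: (Delta y) => t; tens_elim t c d.
      by rewrite tinterchangeE !tmapE /= tswapE tmapE !alg_ofE idlE !mulrA.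
    by rewrite antipoder -scalerAr mulr1 scalerAl.
  by rewrite antipoder scalerA mulrC.
Qed.

(** Since [eps] is multiplicative, [eps(S x) = eps(S(x_1) x_2)], and the antipode axiom applies. *)
Lemma counit_antipode x : eps (S x) = eps x.
Proof.
rewrite -{1}(comul_counitr x).
transitivity (eps (mm ((S ⊠ idl) (Delta x)))).
  move: (Delta x) => t; tens_elim t a b.
  by rewrite !tmapE trunitE alg_ofE !linearZZ idlE counitM /= mulrC.
by rewrite antipodel linearZZ counit1 [LHS]mulr1.
Qed.

End Antipode.

(** * Inverses in an associative algebra *)

Section Inverses.
Context (A : comNzRingType) (M : lmodType A) (a : alg M).
Hypothesis a_alg : is_alg a.
Local Notation "x ** y" := (amul a (x ⊙ y)) (at level 40, left associativity).
Local Notation one := (aone a).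

Lemma inverse_uniq x y z : y ** x = one -> x ** z = one -> y = z.
Proof.
by move=> yx xz; rewrite -(alg_mul1r a_alg y) -xz -(alg_assoc a_alg) yx
  alg_mul1l.
Qed.

(** As [y] shows that an inverse exists, [xget] returns an inverse and not its default [0];
    uniqueness does the rest. *)
Lemma ainvE x y : is_inverse a x y -> ainv a x = y.
Proof.
move=> xy; have [/= _ invx] := @xgetPex _ 0 (is_inverse a x) (ex_intro _ y xy).
by case: xy => xy _; apply: inverse_uniq xy.
Qed.

(** Multiply by [x'] on the left and by [w'] on the right. This turns the cocycle condition into its
    other forms. *)
Lemma mul_exchange x x' y z w w' :
  x ** y = z ** w -> x' ** x = one -> w ** w' = one -> y ** w' = x' ** z.
Proof.
move=> xyzw x'x ww'; rewrite -[y](alg_mul1l a_alg) -x'x.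
by rewrite (alg_assoc a_alg x') xyzw -!(alg_assoc a_alg)
  (alg_assoc a_alg (x' ** z)) ww' alg_mul1r.
Qed.

End Inverses.

(** * Coproducts multiplied by fixed elements on both sides *)

Section TripleProducts.
Context (A : comNzRingType) (H : algType A).
Context (Delta : {linear H -> H ⊗ H}) (eps : {linear H -> A^o}).
Context (S : {linear H -> H}).
Hypothesis H_hopf : is_hopf (hopf_of Delta eps S).
Local Notation mm := (amul (alg_of H)).

Lemma HHHA (r s t : H ⊗ H ⊗ H) : r ∗∗ (s ∗∗ t) = r ∗∗ s ∗∗ t.
Proof. exact/esym/(alg_assoc HHH_is_alg). Qed.

Lemma Delta_idl_mul (s t : H ⊗ H) :
  (Delta ⊠ idl) (s ∗ t) = (Delta ⊠ idl) s ∗∗ (Delta ⊠ idl) t.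
Proof.
tens_elim s a b; tens_elim t c d.
by rewrite HHE !tmapE HHHE (comulM H_hopf).
Qed.

Lemma idl_Delta_mul (s t : H ⊗ H) : tassocl ((idl ⊠ Delta) (s ∗ t)) =
  tassocl ((idl ⊠ Delta) s) ∗∗ tassocl ((idl ⊠ Delta) t).
Proof.
tens_elim s a b; tens_elim t c d.
rewrite HHE !tmapE (comulM H_hopf) !idlE; move: (Delta b) (Delta d) => s t.
tens_elim s b1 b2; tens_elim t d1 d2.
by rewrite HHE !tassoclE HHHE HHE.
Qed.

Lemma tens1r_mul (s t : H ⊗ H) :
  (s ∗ t) ⊙ (1 : H) = (s ⊙ 1) ∗∗ (t ⊙ 1).
Proof. by rewrite HHHE mulr1. Qed.

Lemma tens1l_mul (s t : H ⊗ H) :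
  tassocl ((1 : H) ⊙ (s ∗ t)) = tassocl (1 ⊙ s) ∗∗ tassocl (1 ⊙ t).
Proof.
tens_elim s a b; tens_elim t c d.
by rewrite HHE !tassoclE HHHE HHE mulr1.
Qed.

Lemma epsl_mul (s t : H ⊗ H) : tlunit ((eps ⊠ idl) (s ∗ t)) =
  tlunit ((eps ⊠ idl) s) * tlunit ((eps ⊠ idl) t).
Proof.
tens_elim s a b; tens_elim t c d.
by rewrite HHE !tmapE !tlunitE (counitM H_hopf) -scalerAl -scalerAr scalerA.
Qed.

Lemma epsr_mul (s t : H ⊗ H) : trunit ((idl ⊠ eps) (s ∗ t)) =
  trunit ((idl ⊠ eps) s) * trunit ((idl ⊠ eps) t).
Proof.
tens_elim s a b; tens_elim t c d.
by rewrite HHE !tmapE !trunitE (counitM H_hopf) -scalerAl -scalerAr scalerA.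
Qed.

Section TwoSidedTwist.
Context (P Q : H ⊗ H) (K : {linear H -> H ⊗ H}).
Hypothesis KE : forall x, K x = P ∗ Delta x ∗ Q.
Hypothesis P_cocycle : (P ⊙ 1) ∗∗ (Delta ⊠ idl) P =
  tassocl (1 ⊙ P) ∗∗ tassocl ((idl ⊠ Delta) P).
Hypothesis Q_cocycle : (Delta ⊠ idl) Q ∗∗ (Q ⊙ 1) =
  tassocl ((idl ⊠ Delta) Q) ∗∗ tassocl (1 ⊙ Q).

Lemma twisted_idl (t : H ⊗ H) :
  (K ⊠ idl) t = (P ⊙ 1) ∗∗ (Delta ⊠ idl) t ∗∗ (Q ⊙ 1).
Proof.
by tens_elim t a b; rewrite !tmapE !HHHE mulr1 mul1r KE.
Qed.

Lemma tassocl_mul (a : H) (r s t : H ⊗ H) : tassocl (a ⊙ (r ∗ s ∗ t)) =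
  tassocl (1 ⊙ r) ∗∗ tassocl (a ⊙ s) ∗∗ tassocl (1 ⊙ t).
Proof.
tens_elim r r1 r2; tens_elim s s1 s2; tens_elim t t1 t2.
by rewrite 2!HHE 4!tassoclE 2!HHHE 2!HHE mulr1 mul1r.
Qed.

Lemma idl_twisted (t : H ⊗ H) : tassocl ((idl ⊠ K) t) =
  tassocl (1 ⊙ P) ∗∗ tassocl ((idl ⊠ Delta) t) ∗∗ tassocl (1 ⊙ Q).
Proof. by tens_elim t a b; rewrite !tmapE KE idlE tassocl_mul. Qed.

(** Taking [Q = F^-1] and [P = 1 ⊗ 1] gives the coalgebra [C]; taking [P = F] gives that of [H_F].
    In the two iterated coproducts the left factors agree by the cocycle condition on [P], the right
    ones by that on [Q], and the middle ones by coassociativity of [Delta]. *)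
Lemma twisted_is_coalg :
  tlunit ((eps ⊠ idl) P) = 1 -> trunit ((idl ⊠ eps) P) = 1 ->
  tlunit ((eps ⊠ idl) Q) = 1 -> trunit ((idl ⊠ eps) Q) = 1 ->
  is_coalg (Coalg K eps).
Proof.
move=> Pl Pr Ql Qr; split=> x /=.
(* The comparison is made in [H ⊗ H ⊗ H] bracketed to the left, where the product [∗∗] lives. *)
- suff E : (K ⊠ idl) (K x) = tassocl ((idl ⊠ K) (K x)).
    by rewrite E (@tassoclK A H H H).
  rewrite twisted_idl idl_twisted (KE x) !Delta_idl_mul !idl_Delta_mul !HHHA.
  rewrite P_cocycle -!HHHA Q_cocycle -(comul_coassoc H_hopf x)
    (@tassocrK A H H H).
  by [].
- by rewrite KE !epsl_mul Pl Ql (comul_counitl H_hopf) mulr1 mul1r.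
- by rewrite KE !epsr_mul Pr Qr (comul_counitr H_hopf) mulr1 mul1r.
Qed.

End TwoSidedTwist.
End TripleProducts.

(** * The twist, its inverse and the element [u] *)

Section TwistElement.
Context (A : comNzRingType) (H : algType A).
Context (Delta : {linear H -> H ⊗ H}) (eps : {linear H -> A^o}).
Context (S : {linear H -> H}).
Hypothesis H_hopf : is_hopf (hopf_of Delta eps S).
Local Notation mm := (amul (alg_of H)).
Context (F : H ⊗ H).
Hypothesis F_twist : is_twist (hopf_of Delta eps S) F.
Local Notation F' := (twist_inv F).
Local Notation u := (twist_u S F).
Local Notation u' := (twist_u_inv S F).

Lemma twist_mulV : F ∗ F' = 1 ⊙ 1.
Proof.
have [G FG] := twist_invertible F_twist.
by rewrite /twist_inv (ainvE HH_is_alg FG); case: FG.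
Qed.

Lemma twist_mulVl : F' ∗ F = 1 ⊙ 1.
Proof.
have [G FG] := twist_invertible F_twist.
by rewrite /twist_inv (ainvE HH_is_alg FG); case: FG.
Qed.

Lemma twist_epsl : tlunit ((eps ⊠ idl) F) = 1.
Proof. exact: twist_counitl F_twist. Qed.

Lemma twist_epsr : trunit ((idl ⊠ eps) F) = 1.
Proof. exact: twist_counitr F_twist. Qed.

Lemma twistV_epsl : tlunit ((eps ⊠ idl) F') = 1.
Proof.
have := epsl_mul H_hopf F F'.
by rewrite twist_epsl mul1r => <-; rewrite twist_mulV tmapE tlunitE
  (counit1 H_hopf) scale1r.
Qed.

Lemma twistV_epsr : trunit ((idl ⊠ eps) F') = 1.
Proof.
have := epsr_mul H_hopf F F'.
by rewrite twist_epsr mul1r => <-; rewrite twist_mulV tmapE trunitE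
  (counit1 H_hopf) scale1r.
Qed.

Lemma twist_cocycleE : (F ⊙ 1) ∗∗ (Delta ⊠ idl) F =
  tassocl (1 ⊙ F) ∗∗ tassocl ((idl ⊠ Delta) F).
Proof. exact: twist_cocycle F_twist. Qed.

Let one3 : H ⊗ H ⊗ H := 1 ⊙ 1 ⊙ 1.

Lemma Delta_idl1 : (Delta ⊠ idl) (1 ⊙ 1) = one3.
Proof. by rewrite tmapE (comul1 H_hopf). Qed.

Lemma idl_Delta1 : tassocl ((idl ⊠ Delta) (1 ⊙ 1)) = one3.
Proof. by rewrite tmapE (comul1 H_hopf) tassoclE. Qed.

(** The cocycle condition with one factor of each side moved across. Each side then involves [F] and
    [F^-1] once, as the product of [u] and its candidate inverse does. *)
Lemma twist_exchangel : (Delta ⊠ idl) F ∗∗ tassocl ((idl ⊠ Delta) F') =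
  (F' ⊙ 1) ∗∗ tassocl (1 ⊙ F).
Proof.
apply: (mul_exchange HHH_is_alg twist_cocycleE).
  by rewrite -tens1r_mul twist_mulVl.
by rewrite -(idl_Delta_mul H_hopf) twist_mulV idl_Delta1.
Qed.

Lemma twist_exchanger : tassocl ((idl ⊠ Delta) F) ∗∗ (Delta ⊠ idl) F' =
  tassocl (1 ⊙ F') ∗∗ (F ⊙ 1).
Proof.
apply: (mul_exchange HHH_is_alg (esym twist_cocycleE)).
  by rewrite -tens1l_mul twist_mulVl tassoclE.
by rewrite -(Delta_idl_mul H_hopf) twist_mulV Delta_idl1.
Qed.

(** A second exchange inverts the remaining two factors; the result is the condition on [Q] for
    twisted coproducts. *)
Lemma twistV_cocycle : (Delta ⊠ idl) F' ∗∗ (F' ⊙ 1) =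
  tassocl ((idl ⊠ Delta) F') ∗∗ tassocl (1 ⊙ F').
Proof.
apply/esym; apply: (mul_exchange HHH_is_alg twist_exchangel).
  by rewrite -(Delta_idl_mul H_hopf) twist_mulVl Delta_idl1.
by rewrite -tens1l_mul twist_mulV tassoclE.
Qed.

Let v := mm ((S ⊠ idl) F').

(* Both identities evaluate a form of the cocycle condition: the first under
   a ⊗ b ⊗ c |-> S a * b * S c, the second under a * S b * c. *)
Lemma twist_u_mulVl : v * u = 1.
Proof.
pose L : {linear H ⊗ H ⊗ H -> H} := mm \o ((mm \o (S ⊠ idl)) ⊠ S).
have LE a b c : L (a ⊙ b ⊙ c) = S a * b * S c.
  by rewrite /L /= tmapE /= tmapE !alg_ofE idlE.
transitivity (L ((F' ⊙ 1) ∗∗ tassocl (1 ⊙ F))).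
  rewrite /v /twist_u; move: F' => t; move: (F) => s.
  tens_elim t a b; tens_elim s c d.
  by rewrite tassoclE HHHE HHE LE !tmapE !alg_ofE !idlE mulr1 mul1r !mulrA.
rewrite -twist_exchangel.
(* The antipode axioms collapse [Delta] of the first leg of [F] and of the second leg of [F^-1] to
   counits, which then act on [F] and [F^-1]. *)
transitivity (S (trunit ((idl ⊠ eps) F')) * S (tlunit ((eps ⊠ idl) F))).
  move: F' => s; move: (F) => t; tens_elim t a b; tens_elim s c d.
  rewrite !tmapE !idlE tlunitE trunitE !linearZZ.
  transitivity
    (S c * mm ((S ⊠ idl) (Delta a)) * mm ((idl ⊠ S) (Delta d)) * S b).
    move: (Delta a) (Delta d) => s t; tens_elim s x y; tens_elim t z w.
    by rewrite tassoclE HHHE HHE LE !tmapE !alg_ofE !idlE !(antipodeM H_hopf)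
      !mulrA.
  rewrite (antipodel H_hopf) (antipoder H_hopf).
  by rewrite /= -!scalerAl -!scalerAr -!scalerAl !mulr1.
by rewrite twistV_epsr twist_epsl (antipode1 H_hopf) mulr1.
Qed.

Lemma twist_u_mulV : u * v = 1.
Proof.
pose L : {linear H ⊗ H ⊗ H -> H} := mm \o ((mm \o (idl ⊠ S)) ⊠ idl).
have LE a b c : L (a ⊙ b ⊙ c) = a * S b * c.
  by rewrite /L /= tmapE /= tmapE !alg_ofE !idlE.
transitivity (L (tassocl (1 ⊙ F') ∗∗ (F ⊙ 1))).
  rewrite /v /twist_u; move: F' => t; move: (F) => s.
  tens_elim t a b; tens_elim s c d.
  by rewrite tassoclE HHHE HHE LE !tmapE !alg_ofE !idlE (antipodeM H_hopf) mulr1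
    mul1r !mulrA.
rewrite -twist_exchanger.
transitivity (trunit ((idl ⊠ eps) F) * tlunit ((eps ⊠ idl) F')).
  move: F' => s; move: (F) => t; tens_elim t a b; tens_elim s c d.
  rewrite !tmapE !idlE tlunitE trunitE.
  transitivity (a * mm ((idl ⊠ S) (Delta c)) * mm ((S ⊠ idl) (Delta b)) * d).
    move: (Delta c) (Delta b) => s t; tens_elim s x y; tens_elim t z w.
    by rewrite tassoclE HHHE HHE LE !tmapE !alg_ofE !idlE !(antipodeM H_hopf)
      !mulrA.
  rewrite (antipodel H_hopf) (antipoder H_hopf).
  by rewrite /= -!scalerAl -!scalerAr -!scalerAl !mulr1.
by rewrite twist_epsr twistV_epsl mulr1.
Qed.

(** [u'] is defined by choosing an inverse; uniqueness turns it into the explicit formula. *)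
Lemma twist_u_invE : u' = v.
Proof.
apply: (ainvE (alg_of_is_alg H)).
by split; rewrite alg_ofE ?twist_u_mulV ?twist_u_mulVl.
Qed.

Lemma twist_uV : u * u' = 1. Proof. by rewrite twist_u_invE twist_u_mulV. Qed.
Lemma twist_Vu : u' * u = 1. Proof. by rewrite twist_u_invE twist_u_mulVl. Qed.

End TwistElement.

(** * The coalgebra [C] *)

Section TwistedCoalgebra.
Context (A : comNzRingType) (H : algType A).
Context (Delta : {linear H -> H ⊗ H}) (eps : {linear H -> A^o}).
Context (S : {linear H -> H}).
Hypothesis H_hopf : is_hopf (hopf_of Delta eps S).
Local Notation mm := (amul (alg_of H)).
Context (F : H ⊗ H).
Hypothesis F_twist : is_twist (hopf_of Delta eps S) F.
Local Notation F' := (twist_inv F).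
Local Notation u := (twist_u S F).
Local Notation u' := (twist_u_inv S F).
Local Notation D := (mk_linear (twist_comul_C_linear Delta F)).
Local Notation C := (twist_coalg_C Delta eps F).
Local Notation nu := (twist_nu S F).
Local Notation theta := (twist_theta S F).

Lemma twist_comul_CE x : D x = Delta x ∗ F'.
Proof. by rewrite mk_linearE. Qed.

Lemma twist_coalg_C_is_coalg : is_coalg C.
Proof.
apply: (twisted_is_coalg H_hopf (P := 1 ⊙ 1) (Q := F')).
- by move=> x; rewrite twist_comul_CE HH1l.
- by rewrite !tmapE (comul1 H_hopf) !tassoclE.
- by rewrite (twistV_cocycle H_hopf F_twist).
- by rewrite tmapE tlunitE (counit1 H_hopf) scale1r.
- by rewrite tmapE trunitE (counit1 H_hopf) scale1r.
- by rewrite (twistV_epsl H_hopf F_twist).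
- by rewrite (twistV_epsr H_hopf F_twist).
Qed.

Lemma comul_C_coassoc x : tassocr ((D ⊠ idl) (D x)) = (idl ⊠ D) (D x).
Proof. exact: (coassocE x twist_coalg_C_is_coalg). Qed.

Lemma comul_C_counitl x : tlunit ((eps ⊠ idl) (D x)) = x.
Proof. exact: (counitlE x twist_coalg_C_is_coalg). Qed.

(** * The convolution inverse [beta] of the identity, and its coproduct *)

Lemma beta_linear : linear (fun x => u * S x).
Proof. by move=> a x y; rewrite linearP mulrPr. Qed.

Definition beta : {linear H -> H} := mk_linear beta_linear.

Lemma betaE x : beta x = u * S x.
Proof. by rewrite mk_linearE. Qed.

Lemma beta1 : beta 1 = u.
Proof. by rewrite betaE (antipode1 H_hopf) mulr1. Qed.

(** Writing out [u] between the two legs of [F^-1] gives [a S(b)] evaluated on [F^-1 F]. *)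
Lemma beta_twistV : mm ((idl ⊠ beta) F') = 1.
Proof.
transitivity (mm ((idl ⊠ S) (F' ∗ F))).
  move: F' => t; tens_elim t a b.
  rewrite tmapE alg_ofE betaE idlE /twist_u; move: (F) => t; tens_elim t c d.
  by rewrite HHE !tmapE !alg_ofE !idlE (antipodeM H_hopf) !mulrA.
by rewrite (twist_mulVl F_twist) tmapE alg_ofE (antipode1 H_hopf) mulr1.
Qed.

(** With [F^-1 = c ⊗ d], the left side is [x_1 (c beta(d)) S(x_2)]: the inner factor is 1 by
    [beta_twistV], and the antipode axiom remains. *)
Lemma idl_beta x : mm ((idl ⊠ beta) (D x)) = (eps x : A) *: 1.
Proof.
rewrite twist_comul_CE -(antipoder H_hopf); move: (Delta x) => t;
  tens_elim t a b.
rewrite tmapE alg_ofE idlE.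
transitivity (a * mm ((idl ⊠ beta) F') * S b);
  last by rewrite beta_twistV mulr1.
move: F' => t; tens_elim t c d.
by rewrite HHE !tmapE !alg_ofE !idlE !betaE (antipodeM H_hopf) !mulrA.
Qed.

Lemma beta_idl x : mm ((beta ⊠ idl) (D x)) = (eps x : A) *: 1.
Proof.
(* The unit is written as [u] times the explicit inverse, so that both sides become linear in
   [F^-1]. *)
rewrite twist_comul_CE -(twist_uV H_hopf F_twist) (twist_u_invE H_hopf F_twist).
move: F' => t; tens_elim t c d; rewrite tmapE alg_ofE idlE.
transitivity (u * S c * mm ((S ⊠ idl) (Delta x)) * d).
  move: (Delta x) => t; tens_elim t a b.
  by rewrite HHE !tmapE !alg_ofE !idlE !betaE (antipodeM H_hopf) !mulrA.
by rewrite (antipodel H_hopf) -scalerAr mulr1 -scalerAl !mulrA.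
Qed.

(** Applied to a fourfold coproduct of [C], this is the convolution product of [Delta] and its
    candidate inverse. *)
Let Omega : {linear H ⊗ H ⊗ (H ⊗ H) -> H ⊗ H} :=
  amul (HH H) \o (idl ⊠ ((beta ⊠ beta) \o tswap)).

Lemma OmegaE (a b c d : H) :
  Omega (a ⊙ b ⊙ (c ⊙ d)) = (a * beta d) ⊙ (b * beta c).
Proof. by rewrite /Omega /= tmapE /= tswapE tmapE HHE. Qed.

Lemma idl_D_tassocl (y : H) (w : H ⊗ H) :
  (idl ⊠ D) (tassocl (y ⊙ w)) = tassocl (y ⊙ (idl ⊠ D) w).
Proof. by tens_elim w b c; rewrite tassoclE !tmapE tassoclE. Qed.

(** With [z_1 ⊗ z_2 ⊗ z_3] the iterated coproduct of [z] in [C], the second leg is [z_1 beta(z_2)],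
    which [idl_beta] collapses. *)
Lemma Omega_D (y z : H) :
  Omega (tassocl (y ⊙ (idl ⊠ D) (D z))) = (y * beta z) ⊙ 1.
Proof.
rewrite -comul_C_coassoc -{2}[z]comul_C_counitl; move: (D z) => t;
  tens_elim t p q.
rewrite !tmapE tlunitE linearZZ idlE -scalerAr tensZl -tensZr -idl_beta.
move: (D p) => t; tens_elim t b c.
by rewrite tassocrE tassoclE OmegaE tmapE alg_ofE.
Qed.

Lemma comul_beta x :
  Delta (beta x) = F' ∗ (beta ⊠ beta) (tswap (D x)).
Proof.
pose h : {linear H -> H ⊗ H} :=
  amul (HH H) \o tensl_lin (H ⊗ H) F' \o (beta ⊠ beta) \o tswap \o D.
have hE y : h y = F' ∗ (beta ⊠ beta) (tswap (D y)).
  by rewrite /h /= (mk_linearE (tens_linearr F')).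
rewrite -hE; move: x.
apply: (convolution_inverse_uniq (f := Delta \o beta) (g := Delta)
  twist_coalg_C_is_coalg HH_is_alg).
- move=> x; rewrite aone_tens aone_alg_of -(comul1 H_hopf) -linearZZ -beta_idl.
  rewrite -[comul C x]/(D x); move: (D x) => t; tens_elim t a b.
  by rewrite !tmapE alg_ofE (comulM H_hopf).
- move=> x; rewrite aone_tens aone_alg_of -tensZl -idl_beta.
  (* The factor [F^-1] at the head of [h] is absorbed on its left, turning [Delta] into [D]. *)
  transitivity (Omega ((idl ⊠ D) ((D ⊠ idl) (D x)))).
    rewrite -[comul C x]/(D x); move: (D x) => t; tens_elim t a b.
    by rewrite !tmapE hE !twist_comul_CE HHA /Omega /= tmapE !idlE.
  (* Rebracketing splits three legs off the right component, as [Omega_D] requires; [y beta(z) ⊗ 1]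
     is left. *)
  rewrite -[(D ⊠ idl) _](@tassocrK A H H H) comul_C_coassoc.
  move: (D x) => t; tens_elim t y z.
  by rewrite !tmapE alg_ofE idlE idl_D_tassocl Omega_D.
Qed.

(** * Coproducts and counits of [u], of its inverse and of antipodes *)

Lemma S_tswap_mul (s t : H ⊗ H) : (S ⊠ S) (tswap (s ∗ t)) =
  (S ⊠ S) (tswap t) ∗ (S ⊠ S) (tswap s).
Proof.
tens_elim s a b; tens_elim t c d.
by rewrite HHE !tswapE !tmapE HHE !(antipodeM H_hopf).
Qed.

Lemma beta_tens (t : H ⊗ H) : (beta ⊠ beta) t = (u ⊙ u) ∗ (S ⊠ S) t.
Proof. by tens_elim t a b; rewrite !tmapE HHE !betaE. Qed.

Local Notation G := ((S ⊠ S) (tswap F')).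

(** This is [comul_beta] at 1. *)
Lemma comul_twist_u : Delta u = F' ∗ ((u ⊙ u) ∗ G).
Proof. by rewrite -{1}beta1 comul_beta twist_comul_CE (comul1 H_hopf) HH1l
  beta_tens. Qed.

Lemma comul_twist_Vu : Delta u' ∗ Delta u = 1 ⊙ 1.
Proof. by rewrite -(comulM H_hopf) (twist_Vu H_hopf F_twist) (comul1 H_hopf).
  Qed.

Lemma comul_twist_uV : Delta u ∗ Delta u' = 1 ⊙ 1.
Proof. by rewrite -(comulM H_hopf) (twist_uV H_hopf F_twist) (comul1 H_hopf).
  Qed.

(** By [comul_beta] and [comul_twist_u], the two sides agree after left multiplication by [Delta u],
    which is invertible. *)
Lemma comul_antipode x : Delta (S x) = (S ⊠ S) (tswap (Delta x)).
Proof.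
rewrite -[LHS]HH1l -[RHS]HH1l -comul_twist_Vu -!HHA; congr (amul _ (_ ⊙ _)).
rewrite -(comulM H_hopf) -betaE comul_beta twist_comul_CE beta_tens S_tswap_mul.
by rewrite comul_twist_u !HHA.
Qed.

(** As [eps] is multiplicative and invariant under [S], this is [eps] of the counit condition on
    [F]. *)
Lemma counit_twist_u : eps u = 1.
Proof.
rewrite -(counit1 H_hopf) -(twist_epsr F_twist) /twist_u.
move: (F) => t; tens_elim t a b.
by rewrite !tmapE alg_ofE trunitE (counitM H_hopf) linearZZ
  (counit_antipode H_hopf) idlE [RHS]mulrC.
Qed.

Lemma counit_twist_u_inv : eps u' = 1.
Proof.
have := counitM H_hopf u u'.
by rewrite counit_twist_u (twist_uV H_hopf F_twist) (counit1 H_hopf) mul1r.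
Qed.

(** * [nu] and [theta] as coalgebra maps *)

Lemma nu_tens (t w s : H ⊗ H) :
  (nu ⊠ nu) (tinterchange (tinterchange (t ⊙ tswap w) ⊙ s)) =
  t ∗ (beta ⊠ beta) (tswap w) ∗ s.
Proof.
tens_elim t a b; tens_elim w c d; tens_elim s x y.
rewrite tswapE !tinterchangeE !tmapE !HHE !twist_nuE !betaE.
by rewrite !mulrA.
Qed.

(** Here [nu] sends [x ⊗ y ⊗ z] to [x beta(y) z]. In the coproduct of that product, the [F^-1]
    supplied by [comul_beta] joins [Delta x], and the one from [D] joins [Delta z]. *)
Lemma twist_nu_coalg_morph : coalg_morph (tens_coalg (tens_coalg C (cop C)) C) C
  nu.
Proof.
split=> t.
- tens_elim t s z; tens_elim s x y.
  rewrite /= tmapE /= tmapE /= nu_tens twist_nuE -[_ * u * _]mulrA -betaE.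
  by rewrite !twist_comul_CE !(comulM H_hopf) comul_beta twist_comul_CE !HHA.
- tens_elim t s z; tens_elim s x y.
  rewrite /= tmapE /= tmapE !tlunitE twist_nuE !(counitM H_hopf).
  by rewrite counit_twist_u (counit_antipode H_hopf) mulr1.
Qed.

Lemma twist_thetaE x : theta x = S (S x) * S u * u'.
Proof. by rewrite mk_linearE. Qed.

Lemma SS_mul (s t : H ⊗ H) : (S ⊠ S) ((S ⊠ S) (s ∗ t)) =
  (S ⊠ S) ((S ⊠ S) s) ∗ (S ⊠ S) ((S ⊠ S) t).
Proof.
tens_elim s a b; tens_elim t c d.
by rewrite HHE !tmapE HHE !(antipodeM H_hopf).
Qed.

Lemma S_tswap2 (t : H ⊗ H) :
  (S ⊠ S) (tswap ((S ⊠ S) (tswap t))) = (S ⊠ S) ((S ⊠ S) t).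
Proof. by tens_elim t a b; rewrite tswapE tmapE tswapE !tmapE. Qed.

Lemma theta_tens (t : H ⊗ H) :
  (theta ⊠ theta) t = (S ⊠ S) ((S ⊠ S) t) ∗ ((S u ⊙ S u) ∗ (u' ⊙ u')).
Proof. by tens_elim t a b; rewrite !tmapE !HHE !twist_thetaE !mulrA. Qed.

(** The formula of [comul_twist_u], inverted: multiplying the left side by [u ⊗ u] on the left gives
    [F (Delta u) (Delta u') F^-1 = 1]. *)
Lemma comul_twist_u_inv : G ∗ (Delta u' ∗ F') = u' ⊙ u'.
Proof.
rewrite -[G]HH1l -(twist_Vu H_hopf F_twist) -(HHE u' u' u u).
rewrite -(HHA _ _ G) -[(u ⊙ u) ∗ G]HH1l -(twist_mulV F_twist).
rewrite -(HHA F) -comul_twist_u -!HHA (HHA (Delta u)) comul_twist_uV HH1l.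
by rewrite (twist_mulV F_twist) HH1r.
Qed.

(** Expanding [Delta (S u)] by [comul_twist_u] yields a factor [S^2 ⊗ S^2] of [F^-1], which
    completes [Delta x] to [D x], and a final [G], which [comul_twist_u_inv] absorbs. *)
Lemma twist_theta_coalg_morph : coalg_morph C C theta.
Proof.
split=> x /=.
- rewrite theta_tens !twist_comul_CE twist_thetaE !(comulM H_hopf)
    !comul_antipode S_tswap2 comul_twist_u.
  rewrite !S_tswap_mul S_tswap2 tswapE tmapE SS_mul -!HHA.
  by rewrite comul_twist_u_inv !HHA.
- by rewrite twist_thetaE !(counitM H_hopf) !(counit_antipode H_hopf)
    counit_twist_u counit_twist_u_inv !mulr1.
Qed.

Lemma twist_theta_bij : bijective S -> bijective theta.
Proof.
(* [u S(u')] is the inverse of the factor [S(u) u'] in [theta]; what remains is [S^2]. *)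
case=> Si SK KS; exists (fun x => Si (Si (x * (u * S u')))) => x.
- rewrite twist_thetaE -!mulrA (mulrA u') (twist_Vu H_hopf F_twist) mul1r.
  by rewrite -(antipodeM H_hopf) (twist_Vu H_hopf F_twist) (antipode1 H_hopf)
    mulr1 !SK.
- rewrite twist_thetaE !KS -!mulrA (mulrA (S u')) -(antipodeM H_hopf).
  by rewrite (twist_uV H_hopf F_twist) (antipode1 H_hopf) mul1r
    (twist_uV H_hopf F_twist) mulr1.
Qed.

(** * The cotorsor axioms *)

Lemma twist_is_cotorsor : bijective S -> is_cotorsor (Cotorsor C nu theta).
Proof.
move=> S_bij; split=> //=.
- exact: twist_coalg_C_is_coalg.
- exact: twist_nu_coalg_morph.
- by split; [exact: twist_theta_coalg_morph | exact: twist_theta_bij].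
- move=> t /=; tens_elim t x y; rewrite !tmapE tlunitE idlE.
  rewrite -[y in RHS]mul1r scalerAl -idl_beta.
  move: (D x) => t; tens_elim t a b.
  by rewrite twist_nuE tmapE alg_ofE betaE idlE mulrA.
- move=> t /=; tens_elim t x y; rewrite !tmapE trunitE idlE.
  rewrite -[x in RHS]mulr1 scalerAr -beta_idl.
  move: (D y) => t; tens_elim t a b.
  by rewrite tassoclE twist_nuE tmapE alg_ofE betaE idlE !mulrA.
- move=> t /=; tens_elim t t5 x5; tens_elim t5 t4 x4; tens_elim t4 t3 x3.
  tens_elim t3 x1 x2.
  by rewrite tassoc4E !tmapE !twist_nuE !idlE !mulrA.
- move=> t /=; tens_elim t t5 x5; tens_elim t5 t4 x4; tens_elim t4 t3 x3.
  tens_elim t3 x1 x2.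
  (* [S] of the inner product contains [S^2(x3) S(u)], which is [theta(x3) u]: this identity
     dictates the formula for [theta]. *)
  rewrite !tmapE tassoc4E !tmapE /= tswap13E !twist_nuE !idlE twist_thetaE.
  by rewrite !(antipodeM H_hopf) -!mulrA (mulrA u' u) (twist_Vu H_hopf F_twist)
    mul1r.
- move=> t /=; tens_elim t t3 x3; tens_elim t3 x1 x2.
  rewrite !tmapE !twist_nuE !twist_thetaE !(antipodeM H_hopf) -!mulrA
    (mulrA u' u).
  rewrite (twist_Vu H_hopf F_twist) mul1r; congr (_ * _).
  (* The [S u] left by the first [theta] meets the [S u'] from the second one under [S]. *)
  by rewrite (mulrA (S u)) -(antipodeM H_hopf) (twist_Vu H_hopf F_twist)
    (antipode1 H_hopf) mul1r.
Qed.

End TwistedCoalgebra.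

(** * Transport of Hopf structures along a linear isomorphism *)

Section HopfTransport.
Context (A : comNzRingType) (M N : lmodType A).
Context (f : {linear M -> N}) (g : {linear N -> M}).
Hypotheses (fK : cancel f g) (gK : cancel g f).
Context (h : hopf N).
Hypothesis h_hopf : is_hopf h.

(** The quotients [Hl] and [Hr] receive their structures in this way, so that no structure map has
    to be descended to a quotient. *)
Definition hopf_pullback : hopf M :=
  Hopf (Alg (g \o amul h \o (f ⊠ f)) (g (aone h)))
       (Coalg ((g ⊠ g) \o comul h \o f) (counit h \o f))
       (g \o antipode h \o f).
Local Notation X := hopf_pullback.

Lemma pullback_amulE x y : amul X (x ⊙ y) = g (amul h (f x ⊙ f y)).
Proof. by rewrite /= tmapE. Qed.

Lemma pullback_tens_amulE (s t : M ⊗ M) : amul (tens_alg X X) (s ⊙ t) =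
  (g ⊠ g) (amul (tens_alg h h) ((f ⊠ f) s ⊙ (f ⊠ f) t)).
Proof.
tens_elim s a b; tens_elim t c d.
by rewrite !tmapE !tens_amulE !pullback_amulE tmapE.
Qed.

Lemma pullback_fgK (t : N ⊗ N) : (f ⊠ f) ((g ⊠ g) t) = t.
Proof. by tens_elim t x y; rewrite !tmapE !gK. Qed.

Lemma pullback_is_hopf : is_hopf X.
Proof.
have h_alg := hopf_is_alg h_hopf; have h_coalg := hopf_is_coalg h_hopf.
split.
- split=> [x y z|x|x]; rewrite !pullback_amulE !gK.
  + by rewrite (alg_assoc h_alg).
  + by rewrite (alg_mul1l h_alg) fK.
  + by rewrite (alg_mul1r h_alg) fK.
- split=> x /=.
  + transitivity ((g ⊠ (g ⊠ g)) ((idl ⊠ comul h) (comul h (f x)))).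
      rewrite -coassocE //; move: (comul h (f x)) => t; tens_elim t y z.
      rewrite !tmapE /= gK; move: (comul h y) => t; tens_elim t a b.
      by rewrite !tassocrE !tmapE tassocrE !idlE.
    move: (comul h (f x)) => t; tens_elim t y z.
    by rewrite !tmapE /= gK.
  + transitivity (g (tlunit ((counit h ⊠ idl) (comul h (f x)))));
      last by rewrite counitlE // fK.
    move: (comul h (f x)) => t; tens_elim t y z.
    by rewrite !tmapE !tlunitE /= gK linearZZ.
  + transitivity (g (trunit ((idl ⊠ counit h) (comul h (f x)))));
      last by rewrite counitrE // fK.
    move: (comul h (f x)) => t; tens_elim t y z.
    by rewrite !tmapE !trunitE /= gK linearZZ.
- split.
  + move=> t; tens_elim t x y.
    have := alg_morph_mul (hopf_comul_morph h_hopf) (f x ⊙ f y).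
    rewrite /= !tmapE pullback_tens_amulE /= gK !pullback_fgK.
    by move=> ->.
  + have := alg_morph_one (hopf_comul_morph h_hopf).
    by rewrite /= gK => ->; rewrite !aone_tens tmapE.
- split.
  + move=> t; tens_elim t x y.
    have := alg_morph_mul (hopf_counit_morph h_hopf) (f x ⊙ f y).
    by rewrite /= !tmapE /= gK.
  + by have := alg_morph_one (hopf_counit_morph h_hopf); rewrite /= gK.
- move=> x; rewrite /= -linearZZ -(hopf_antipodel h_hopf).
  move: (comul h (f x)) => t; tens_elim t y z.
  by rewrite !tmapE /= !gK.
- move=> x; rewrite /= -linearZZ -(hopf_antipoder h_hopf).
  move: (comul h (f x)) => t; tens_elim t y z.
  by rewrite !tmapE /= !gK.
Qed.

Lemma pullback_iso : hopf_iso X h f.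
Proof.
split.
- by exists g.
- by split=> [t|] /=; rewrite gK.
- by split=> [x|x] //=; rewrite pullback_fgK.
- by move=> x /=; rewrite gK.
Qed.

End HopfTransport.

(** * The twisted Hopf algebra [H_F] *)

Section Main.
Context (A : comNzRingType) (H : algType A).
Context (Delta : {linear H -> H ⊗ H}) (eps : {linear H -> A^o}).
Context (S : {linear H -> H}).
Hypothesis H_hopf : is_hopf (hopf_of Delta eps S).
Local Notation mm := (amul (alg_of H)).
Context (F : H ⊗ H).
Hypothesis F_twist : is_twist (hopf_of Delta eps S) F.
Local Notation F' := (twist_inv F).
Local Notation u := (twist_u S F).
Local Notation u' := (twist_u_inv S F).
Local Notation D := (mk_linear (twist_comul_C_linear Delta F)).
Local Notation C := (twist_coalg_C Delta eps F).
Local Notation nu := (twist_nu S F).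
Local Notation theta := (twist_theta S F).
Local Notation beta := (beta S F).
Local Notation DF := (mk_linear (twist_comul_linear Delta F)).
Local Notation SF := (mk_linear (twist_antipode_linear S F)).

Lemma twist_comulE x : DF x = F ∗ Delta x ∗ F'.
Proof. by rewrite mk_linearE. Qed.

Lemma twist_comul_C x : DF x = F ∗ D x.
Proof. by rewrite twist_comulE twist_comul_CE HHA. Qed.

Lemma twist_antipodeE x : SF x = u * S x * u'.
Proof. by rewrite mk_linearE. Qed.

(** With [F = c ⊗ d], the factor [S(c) u' d] appears in the middle and equals 1. As the twisted
    coproduct is [F] times [D], the left antipode axiom of [H_F] thus becomes [beta_idl]. *)
Lemma SF_idl (s : H ⊗ H) : mm ((SF ⊠ idl) (F ∗ s)) = mm ((beta ⊠ idl) s).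
Proof.
pose w (x : H) : {linear H -> H} := mk_linear (alg_mul_linearr x).
have wE x y : w x y = x * y by rewrite mk_linearE.
have Fu' : mm ((S ⊠ w u') F) = 1.
  transitivity (mm ((S ⊠ idl) (F' ∗ F))).
    rewrite (twist_u_invE H_hopf F_twist).
    move: F' => t; move: (F) => r; tens_elim r c d; rewrite tmapE alg_ofE wE.
    tens_elim t a b.
    by rewrite HHE !tmapE !alg_ofE (antipodeM H_hopf) !idlE !mulrA.
  by rewrite (twist_mulVl F_twist) tmapE alg_ofE (antipode1 H_hopf) mulr1.
have SF_mul (t : H ⊗ H) (a b : H) :
    mm ((SF ⊠ idl) (t ∗ (a ⊙ b))) = u * S a * mm ((S ⊠ w u') t) * b.
  tens_elim t c d.
  by rewrite HHE !tmapE !alg_ofE twist_antipodeE wE idlE (antipodeM H_hopf)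
    !mulrA.
by tens_elim s a b; rewrite SF_mul Fu' tmapE alg_ofE betaE idlE mulr1.
Qed.

(** For [t = F] and [s = D x], the right side is [eps(x) u u'], which is the right antipode axiom of
    [H_F]. *)
Lemma idl_SF (t s : H ⊗ H) a : mm ((idl ⊠ beta) s) = a *: 1 ->
  mm ((idl ⊠ SF) (t ∗ s)) = a *: 1 * mm ((idl ⊠ S) t) * u'.
Proof.
move=> sa; tens_elim t p q; rewrite tmapE alg_ofE idlE.
transitivity (p * (a *: 1) * S q * u').
  rewrite -sa; move: s {sa} => t; tens_elim t b c.
  by rewrite HHE !tmapE !alg_ofE twist_antipodeE betaE !idlE (antipodeM H_hopf)
    !mulrA.
by rewrite -scalerAr mulr1 -!scalerAl mul1r.
Qed.

Lemma hopf_twist_is_hopf : is_hopf (hopf_twist Delta eps S F).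
Proof.
split.
- exact: alg_of_is_alg.
- apply: (twisted_is_coalg H_hopf twist_comulE).
  + exact: twist_cocycleE F_twist.
  + by rewrite (twistV_cocycle H_hopf F_twist).
  + exact: twist_epsl F_twist.
  + exact: twist_epsr F_twist.
  + by rewrite (twistV_epsl H_hopf F_twist).
  + by rewrite (twistV_epsr H_hopf F_twist).
- split=> [t|].
  + tens_elim t x y; rewrite /= tmapE alg_ofE !twist_comulE (comulM H_hopf).
    rewrite -!HHA; congr (F ∗ (_ ∗ _)).
    by rewrite (HHA F') (twist_mulVl F_twist) HH1l.
  + by rewrite /= aone_tens aone_alg_of twist_comulE (comul1 H_hopf) HH1r
      (twist_mulV F_twist).
- exact: hopf_counit_morph H_hopf.
- move=> x; rewrite [LHS](_ : _ = mm ((SF ⊠ idl) (DF x))) //.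
  by rewrite twist_comul_C SF_idl (beta_idl H_hopf F_twist).
- move=> x; rewrite [LHS](_ : _ = mm ((idl ⊠ SF) (DF x))) //.
  rewrite twist_comul_C (idl_SF _ (idl_beta H_hopf F_twist x)).
  by rewrite -[mm _]/u -mulrA (twist_uV H_hopf F_twist) mulr1.
Qed.

End Main.

(** * The Hopf algebras acting on [C], first on the left *)

Section ActingHopfAlgebras.
Context (A : comNzRingType) (H : algType A).
Context (Delta : {linear H -> H ⊗ H}) (eps : {linear H -> A^o}).
Context (S : {linear H -> H}).
Hypothesis H_hopf : is_hopf (hopf_of Delta eps S).
Local Notation mm := (amul (alg_of H)).
Context (F : H ⊗ H).
Hypothesis F_twist : is_twist (hopf_of Delta eps S) F.
Local Notation F' := (twist_inv F).
Local Notation u := (twist_u S F).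
Local Notation u' := (twist_u_inv S F).
Local Notation D := (mk_linear (twist_comul_C_linear Delta F)).
Local Notation C := (twist_coalg_C Delta eps F).
Local Notation nu := (twist_nu S F).
Local Notation theta := (twist_theta S F).
Local Notation beta := (beta S F).
Local Notation DF := (mk_linear (twist_comul_linear Delta F)).
Local Notation T := (Cotorsor C nu theta).

Lemma Hl_relE (a b c d : H) : Hl_rel T (a ⊙ b ⊙ c ⊙ d) =
  (a * u * S b * theta c) ⊙ d - a ⊙ (d * u * S c * b).
Proof.
by rewrite /Hl_rel /= !tmapE tassoc4E tmapE /= tswap13E !twist_nuE !idlE.
Qed.

Lemma Hr_relE (a b c d : H) : Hr_rel T (a ⊙ b ⊙ c ⊙ d) =
  a ⊙ (theta b * u * S c * d) - (c * u * S b * a) ⊙ d.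
Proof.
by rewrite /Hr_rel /= !tmapE tassoc4E tmapE /= tswap13E !twist_nuE !idlE.
Qed.

Opaque Hl_rel Hr_rel.

Lemma Hl_class_eq (t : H ⊗ H ⊗ H ⊗ H) (x y : H ⊗ H) :
  Hl_rel T t = x - y -> Hl_class T x = Hl_class T y.
Proof. by move=> rt; apply/quot_class_eqP; apply: lin_spanS; exists t. Qed.

Lemma Hr_class_eq (t : H ⊗ H ⊗ H ⊗ H) (x y : H ⊗ H) :
  Hr_rel T t = x - y -> Hr_class T x = Hr_class T y.
Proof. by move=> rt; apply/quot_class_eqP; apply: lin_spanS; exists t. Qed.

(** The class of [a ⊗ b] acts on [C] as left multiplication by this element. *)
Definition Hl_phi : {linear H ⊗ H -> H} := mm \o (idl ⊠ beta).

Lemma Hl_phiE (a b : H) : Hl_phi (a ⊙ b) = a * u * S b.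
Proof. by rewrite /Hl_phi /= tmapE alg_ofE betaE idlE mulrA. Qed.

Lemma Hl_phiD t : Hl_phi t = mm ((idl ⊠ beta) t).
Proof. exact: erefl. Qed.
Opaque Hl_phi.

(** The identity [theta(c) u = S^2(c) S(u)] again. *)
Lemma Hl_phi_rel s : range (Hl_rel T) s -> Hl_phi s = 0.
Proof.
case=> t _ <-; tens_elim t t3 d; tens_elim t3 t2 c; tens_elim t2 a b.
rewrite Hl_relE linearB !Hl_phiE twist_thetaE !(antipodeM H_hopf).
by rewrite -!mulrA (mulrA u' u) (twist_Vu H_hopf F_twist) mul1r subrr.
Qed.

Definition Hl_to : {linear Hl T -> H} := quot_lift Hl_phi_rel.

Lemma Hl_toE t : Hl_to (Hl_class T t) = Hl_phi t.
Proof. exact: quot_liftE. Qed.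

Lemma Hl_from_linear : linear (fun x : H => Hl_class T ((x * u') ⊙ (1 : H))).
Proof. by move=> a x y; rewrite mulrPl tensPl linearP. Qed.

Definition Hl_from : {linear H -> Hl T} := mk_linear Hl_from_linear.

Lemma Hl_fromE x : Hl_from x = Hl_class T ((x * u') ⊙ (1 : H)).
Proof. by rewrite mk_linearE. Qed.

(** Modulo the relations every tensor has the form [x ⊗ 1], so they exhaust the kernel of
    [Hl_phi]. *)
Lemma Hl_from_phi t : Hl_from (Hl_phi t) = Hl_class T t.
Proof.
tens_elim t a b; rewrite Hl_fromE Hl_phiE.
(* In this relation [u] cancels the [u'] before [b], leaving [a ⊗ b], while [theta 1 = S(u) u']
   absorbs [S(u')] in the other term. *)
apply: (@Hl_class_eq (a ⊙ (u' * b) ⊙ 1 ⊙ 1)); rewrite Hl_relE twist_thetaE.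
rewrite !(antipodeM H_hopf) !(antipode1 H_hopf) !mul1r !mulr1 !mulrA
  (twist_uV H_hopf F_twist).
by rewrite mul1r -(mulrA _ (S u')) -(antipodeM H_hopf) (twist_uV H_hopf F_twist)
  (antipode1 H_hopf) mulr1.
Qed.

Lemma Hl_toK : cancel Hl_to Hl_from.
Proof. by move=> x; have [t ->] := quot_class_surj x;
  rewrite Hl_toE Hl_from_phi. Qed.

Lemma Hl_fromK : cancel Hl_from Hl_to.
Proof.
move=> x; rewrite Hl_fromE Hl_toE Hl_phiE (antipode1 H_hopf) mulr1.
by rewrite -mulrA (twist_Vu H_hopf F_twist) mulr1.
Qed.

Lemma Hl_phi_tens (t s : H ⊗ H) :
  (Hl_phi ⊠ Hl_phi) (tinterchange (t ⊙ tswap s)) = t ∗ (beta ⊠ beta) (tswap s).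
Proof.
tens_elim t a b; tens_elim s c d.
by rewrite tswapE tinterchangeE !tmapE HHE !Hl_phiE !betaE !mulrA.
Qed.

Definition Hl_hopf : hopf (Hl T) := hopf_pullback Hl_to Hl_from
  (hopf_of Delta eps S).

Lemma Hl_hopf_is_Hl : is_Hl Hl_hopf.
Proof.
split.
- exact: pullback_is_hopf Hl_toK Hl_fromK _ H_hopf.
- split=> t.
  (* Since the class map is [Hl_from] after [Hl_phi], it suffices to compare coproducts in [H]. *)
  + have E s : (Hl_class T ⊠ Hl_class T) s =
        (Hl_from ⊠ Hl_from) ((Hl_phi ⊠ Hl_phi) s).
      by tens_elim s x y; rewrite !tmapE !Hl_from_phi.
    rewrite -[LHS]/((Hl_class T ⊠ Hl_class T) (comul (tens_coalg C (cop C)) t))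
      E.
    rewrite [RHS]/= Hl_toE; congr (_ _).
    tens_elim t a b; rewrite /= tmapE /= Hl_phi_tens Hl_phiE -mulrA -betaE.
    by rewrite (comulM H_hopf) (comul_beta H_hopf F_twist) !twist_comul_CE HHA.
  + rewrite /= Hl_toE; tens_elim t a b.
    rewrite Hl_phiE tmapE tlunitE !(counitM H_hopf) (counit_antipode H_hopf).
    by rewrite (counit_twist_u H_hopf F_twist) mulr1.
- move=> a b c d; rewrite /Hl_hopf pullback_amulE !Hl_toE alg_ofE -Hl_from_phi.
  by rewrite !Hl_phiE twist_nuE !mulrA.
- move=> c; rewrite /= -linearZZ -(idl_beta H_hopf F_twist) -Hl_phiD
    Hl_from_phi.
  by [].
- exists (mm \o (Hl_to ⊠ idl)).
    split=> [x|x y z] /=.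
      by rewrite tmapE Hl_fromK alg_ofE mul1r.
    by rewrite !tmapE /= Hl_fromK !alg_ofE mulrA.
  by move=> a b c; rewrite /= tmapE Hl_toE alg_ofE Hl_phiE twist_nuE.
Qed.

(** * The Hopf algebra acting on the right *)

Definition Hr_phi : {linear H ⊗ H -> H} := mm \o (beta ⊠ idl).

Lemma Hr_phiE (a b : H) : Hr_phi (a ⊙ b) = u * S a * b.
Proof. by rewrite /Hr_phi /= tmapE alg_ofE betaE idlE. Qed.

Lemma Hr_phiD t : Hr_phi t = mm ((beta ⊠ idl) t).
Proof. exact: erefl. Qed.
Opaque Hr_phi.

Lemma Hr_phi_rel s : range (Hr_rel T) s -> Hr_phi s = 0.
Proof.
case=> t _ <-; tens_elim t t3 d; tens_elim t3 t2 c; tens_elim t2 a b.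
rewrite Hr_relE linearB !Hr_phiE twist_thetaE !(antipodeM H_hopf).
by rewrite -!mulrA (mulrA u' u) (twist_Vu H_hopf F_twist) mul1r subrr.
Qed.

Definition Hr_to : {linear Hr T -> H} := quot_lift Hr_phi_rel.

Lemma Hr_toE t : Hr_to (Hr_class T t) = Hr_phi t.
Proof. exact: quot_liftE. Qed.

Lemma Hr_from_linear : linear (fun x : H => Hr_class T ((1 : H) ⊙ (u' * x))).
Proof. by move=> a x y; rewrite mulrPr tensPr linearP. Qed.

Definition Hr_from : {linear H -> Hr T} := mk_linear Hr_from_linear.

Lemma Hr_fromE x : Hr_from x = Hr_class T ((1 : H) ⊙ (u' * x)).
Proof. by rewrite mk_linearE. Qed.

Lemma Hr_from_phi t : Hr_from (Hr_phi t) = Hr_class T t.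
Proof.
tens_elim t a b; rewrite Hr_fromE Hr_phiE.
(* The [u'] after [a] cancels the [u] that the opposite of [nu] inserts, leaving [a ⊗ b]; the other
   term reduces to [1 ⊗ S(a) b]. *)
apply: (@Hr_class_eq (1 ⊙ 1 ⊙ (a * u') ⊙ b)); rewrite Hr_relE twist_thetaE.
rewrite !(antipodeM H_hopf) !(antipode1 H_hopf) !mul1r !mulr1 !mulrA.
rewrite -(mulrA (S u)) (twist_Vu H_hopf F_twist) mulr1 -(antipodeM H_hopf).
rewrite (twist_Vu H_hopf F_twist) (antipode1 H_hopf) !mul1r.
by rewrite -(mulrA a) (twist_Vu H_hopf F_twist) mulr1.
Qed.

Lemma Hr_toK : cancel Hr_to Hr_from.
Proof. by move=> x; have [t ->] := quot_class_surj x;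
  rewrite Hr_toE Hr_from_phi. Qed.

Lemma Hr_fromK : cancel Hr_from Hr_to.
Proof.
move=> x; rewrite Hr_fromE Hr_toE Hr_phiE (antipode1 H_hopf) mulr1.
by rewrite mulrA (twist_uV H_hopf F_twist) mul1r.
Qed.

Lemma Hr_phi_tens (t s : H ⊗ H) :
  (Hr_phi ⊠ Hr_phi) (tinterchange (tswap t ⊙ s)) = (beta ⊠ beta) (tswap t) ∗ s.
Proof.
tens_elim t a b; tens_elim s c d.
by rewrite tswapE tinterchangeE !tmapE HHE !Hr_phiE !betaE.
Qed.

Definition Hr_hopf : hopf (Hr T) :=
  hopf_pullback Hr_to Hr_from (hopf_twist Delta eps S F).

Lemma Hr_hopf_is_Hr : is_Hr Hr_hopf.
Proof.
split.
- exact: pullback_is_hopf Hr_toK Hr_fromK _ (hopf_twist_is_hopf H_hopf F_twist).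
- split=> t.
  + have E s : (Hr_class T ⊠ Hr_class T) s =
        (Hr_from ⊠ Hr_from) ((Hr_phi ⊠ Hr_phi) s).
      by tens_elim s x y; rewrite !tmapE !Hr_from_phi.
    rewrite -[LHS]/((Hr_class T ⊠ Hr_class T) (comul (tens_coalg (cop C) C) t))
      E.
    rewrite [RHS]/= Hr_toE; congr (_ _).
    tens_elim t a b; rewrite /= tmapE /= (Hr_phi_tens (D a) (D b)).
    rewrite Hr_phiE twist_comulE -betaE.
    (* [comul_beta] puts an [F^-1] in front, and only the leading [F] of the twisted coproduct
       removes it; hence [H_F] on this side. *)
    rewrite (comulM H_hopf) (comul_beta H_hopf F_twist) !twist_comul_CE !HHA.
    by rewrite (twist_mulV F_twist) HH1l.
  + rewrite /= Hr_toE; tens_elim t a b.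
    rewrite Hr_phiE tmapE tlunitE !(counitM H_hopf) (counit_antipode H_hopf).
    by rewrite (counit_twist_u H_hopf F_twist) mul1r.
- move=> a b c d; rewrite /Hr_hopf pullback_amulE !Hr_toE alg_ofE -Hr_from_phi.
  by rewrite !Hr_phiE twist_nuE !mulrA.
- move=> c; rewrite /= -linearZZ -(beta_idl H_hopf F_twist) -Hr_phiD
    Hr_from_phi.
  by [].
- exists (mm \o (idl ⊠ Hr_to)).
    split=> [x|x y z] /=.
      by rewrite tmapE Hr_fromK alg_ofE mulr1.
    by rewrite !tmapE /= Hr_fromK !alg_ofE mulrA.
  by move=> a b c; rewrite /= tmapE Hr_toE alg_ofE Hr_phiE twist_nuE !mulrA.
Qed.

End ActingHopfAlgebras.

Theorem theorem3p4 (k : fieldType) (A : comAlgType k)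
    (A_domain : forall a b : A, a * b = 0 -> a = 0 \/ b = 0)
    (H : algType A) (Delta : {linear H -> H ⊗ H}) (eps : {linear H -> A^o})
    (S : {linear H -> H})
    (H_hopf : is_hopf (hopf_of Delta eps S)) (S_bij : bijective S)
    (F : H ⊗ H) (F_twist : is_twist (hopf_of Delta eps S) F) :
  let C := twist_coalg_C Delta eps F in
  let theta := twist_theta S F in
  let nu := twist_nu S F in
  let T := Cotorsor C nu theta in
  [/\ coalg_aut C theta,
      coalg_morph (tens_coalg (tens_coalg C (cop C)) C) C nu,
      is_cotorsor T,
      exists2 X : hopf (Hl T), is_Hl X &
        hopf_isomorphic X (hopf_of Delta eps S) &
      exists2 X : hopf (Hr T), is_Hr X &
        hopf_isomorphic X (hopf_twist Delta eps S F)].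
Proof.
have T_cotorsor := twist_is_cotorsor H_hopf F_twist S_bij.
split=> //.
- exact: ct_theta_aut T_cotorsor.
- exact: ct_nu_morph T_cotorsor.
- exists (Hl_hopf H_hopf F_twist); first exact: Hl_hopf_is_Hl.
  by exists (Hl_to H_hopf F_twist); apply: pullback_iso;
    [exact: Hl_toK|exact: Hl_fromK].
- exists (Hr_hopf H_hopf F_twist); first exact: Hr_hopf_is_Hr.
  by exists (Hr_to H_hopf F_twist); apply: pullback_iso;
    [exact: Hr_toK|exact: Hr_fromK].
Qed.
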